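(* Let $\delta > 0$. There exists a constant $C_0 = C_0(\delta) > 0$ such that $$\left|\mathbf{P}\{\varphi_n^{\mathrm{hor}}\le nx\}-\frac{\sqrt{x}}{\sqrt{x}+\sqrt{1-x}}\right|\le C_0\left(\frac{\log n}{n}\right)^{1/3}$$ and $$\left|\mathbf{P}\{\varphi_n^{\mathrm{ver}}\le nx\}-\frac{\sqrt{x}}{\sqrt{x}+\sqrt{1-x}}\right|\le C_0\left(\frac{\log n}{n}\right)^{1/3}$$ for all $x\in[\delta,1-\delta]$ and all integers $n>1$.
   Context: An up-right path is a finite sequence in $\mathbb{Z}^2$ with steps in $\{(1,0),(0,1)\}$; $\Pi_{p,q}^{m,n}$ is the set of up-right paths from $(p,q)$ to $(m,n)$. Let $\{\omega(i,j):i,j\in\mathbb{Z}_{>0}\}$ be independent exponential random variables of rate $1$, and $G_{p,q}(m,n)=\max_{\pi\in\Pi_{p,q}^{m,n}}\sum_{(i,j)\in\pi}\omega(i,j)$ for $(p,q),(m,n)\in\mathbb{Z}_{>0}^2$, with $\max\emptyset=-\infty$. Restrict to the probability-one event on which, for all $m,n\in\mathbb{Z}_{>0}$, the path in $\Pi_{1,1}^{m,n}$ maximizing $\sum\omega$ (the geodesic) is unique. Then $\mathbb{Z}_{>0}^2\setminus\{(1,1)\}$ is partitioned into $\mathcal{T}^{\mathrm{hor}}=\{(m,n)\in\mathbb{Z}_{>0}^2:G_{2,1}(m,n)>G_{1,2}(m,n)\}$ and $\mathcal{T}^{\mathrm{ver}}=\{(m,n)\in\mathbb{Z}_{>0}^2:G_{2,1}(m,n)<G_{1,2}(m,n)\}$.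 The competition interface is the unique sequence $(\varphi_n^{\mathrm{hor}},\varphi_n^{\mathrm{ver}})_{n\in\mathbb{Z}_{>0}}$ in $\mathbb{Z}_{>0}^2$ such that, for all $n\in\mathbb{Z}_{>0}$, $(\varphi_n^{\mathrm{hor}}+1,\varphi_n^{\mathrm{ver}})\in\mathcal{T}^{\mathrm{hor}}$, $(\varphi_n^{\mathrm{hor}},\varphi_n^{\mathrm{ver}}+1)\in\mathcal{T}^{\mathrm{ver}}$ and $\varphi_n^{\mathrm{hor}}+\varphi_n^{\mathrm{ver}}=n+1$. Existence and uniqueness of this sequence hold on the probability-one event that, for all $m,n\in\mathbb{Z}_{>0}$, the geodesic from $(1,1)$ to $(m,n)$ is unique. *)

(* Defs.v *)
From HB Require Import structures.
From mathcomp Require Import all_boot all_order all_algebra finmap.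
From mathcomp Require Import all_classical all_reals all_analysis.

Set Implicit Arguments.
Unset Strict Implicit.
Unset Printing Implicit Defensive.

Import Order.TTheory GRing.Theory Num.Theory.
Import numFieldNormedType.Exports.

Local Open Scope classical_set_scope.
Local Open Scope ring_scope.

(* Z_{>0}^2, as a subset of nat * nat.  The values of the weights outside of it
   are irrelevant: every path below starts in it, hence stays in it. *)
Definition quadrant : set (nat * nat) :=
  [set z | (0 < z.1)%N /\ (0 < z.2)%N].

Definition up_right_step : rel (nat * nat) :=
  fun u v => (v == (u.1.+1, u.2)) || (v == (u.1, u.2.+1)).

(* A path is the list of all its vertices, both endpoints included. *)
Definition up_right_paths (u v : nat * nat) : set (seq (nat * nat)) :=
  [set p | exists s, [/\ p = u :: s, path up_right_step u s & last u s = v]].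

Lemma finite_up_right_paths (u v : nat * nat) :
  finite_set (up_right_paths u v).
Proof.
have fin n : forall u : nat * nat,
    finite_set [set s | size s = n /\ path up_right_step u s].
  elim: n => [|n IH] u'.
    by apply: (@sub_finite_set _ _ [set [::]]) => // s [/size0nil].
  pose a := (u'.1.+1, u'.2); pose b := (u'.1, u'.2.+1).
  apply: (@sub_finite_set _ _
     (cons a @` [set s | size s = n /\ path up_right_step a s] `|`
      cons b @` [set s | size s = n /\ path up_right_step b s])).
    move=> [|c s] [//= [sn] /andP[/orP[]/eqP-> ps]]; first by left; exists s.
    by right; exists s.
  by rewrite finite_setU; split; apply: finite_image; apply: IH.
apply: (@sub_finite_set _ _ (cons u @` [set s |
    size s = (v.1 + v.2 - (u.1 + u.2))%N /\ path up_right_step u s])).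
  move=> p [s [-> ps sv]]; exists s => //; split=> //; rewrite -sv.
  suff -> : ((last u s).1 + (last u s).2 = size s + (u.1 + u.2))%N.
    by rewrite addnK.
  elim: s u ps {sv} => [|c s IH] u //= /andP[uc /IH->].
  by case/orP: uc => /eqP->/=; rewrite ?addSn ?addnS.
exact/finite_image/fin.
Qed.

Definition path_weight (R : realType) (w : nat * nat -> R)
    (p : seq (nat * nat)) : R := \sum_(z <- p) w z.

(* The supremum is a maximum by [finite_up_right_paths], and it is -oo when
   there is no path. *)
Definition last_passage (R : realType) (w : nat * nat -> R)
    (u v : nat * nat) : \bar R :=
  ereal_sup [set (path_weight w p)%:E | p in up_right_paths u v].

Definition is_geodesic (R : realType) (w : nat * nat -> R)
    (u v : nat * nat) (p : seq (nat * nat)) : Prop :=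
  up_right_paths u v p /\ (path_weight w p)%:E = last_passage w u v.

Definition unique_geodesics (R : realType) (w : nat * nat -> R) : Prop :=
  forall v, quadrant v -> exists! p, is_geodesic w (1%N, 1%N) v p.

Definition T_hor (R : realType) (w : nat * nat -> R) : set (nat * nat) :=
  [set v | quadrant v /\
    (last_passage w (1%N, 2%N) v < last_passage w (2%N, 1%N) v)%E].

Definition T_ver (R : realType) (w : nat * nat -> R) : set (nat * nat) :=
  [set v | quadrant v /\
    (last_passage w (2%N, 1%N) v < last_passage w (1%N, 2%N) v)%E].

Definition is_competition_interface (R : realType) (w : nat * nat -> R)
    (phi : nat -> nat * nat) : Prop :=
  forall n, (0 < n)%N ->
    [/\ quadrant (phi n),
        T_hor w ((phi n).1.+1, (phi n).2),
        T_ver w ((phi n).1, (phi n).2.+1) &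
        ((phi n).1 + (phi n).2 = n.+1)%N].

(* The competition interface is indexed by n > 0, so that the value at 0 is
   irrelevant.  The default value of [xget] is only used when no such sequence
   exists, which does not happen under [unique_geodesics w]. *)
Definition competition_interface (R : realType) (w : nat * nat -> R) :
    nat -> nat * nat :=
  xget (fun=> (0%N, 0%N)) [set phi | is_competition_interface w phi].

Definition phi_hor (R : realType) (w : nat * nat -> R) (n : nat) : nat :=
  (competition_interface w n).1.

Definition phi_ver (R : realType) (w : nat * nat -> R) (n : nat) : nat :=
  (competition_interface w n).2.

Definition mutually_independent (d : measure_display) (T : measurableType d)
    (R : realType) (P : probability T R) (I : choiceType) (D : set I)
    (X : I -> {RV P >-> R}) : Prop :=
  forall (J : {fset I}) (A : I -> set R),
    [set` J] `<=` D -> (forall i, measurable (A i)) ->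
    P (\bigcap_(i in [set` J]) (X i @^-1` A i)) =
    (\prod_(i <- J) P (X i @^-1` A i))%E.

(* [exponential_prob] is a total function on sets, so that it is only compared
   with the distribution of the variable on measurable sets. *)
Definition has_exponential_law (d : measure_display) (T : measurableType d)
    (R : realType) (P : probability T R) (rate : R) (X : {RV P >-> R}) : Prop :=
  forall A : set R, measurable A ->
    distribution P X A = exponential_prob rate A.

Definition iid_exponential_weights (d : measure_display)
    (T : measurableType d) (R : realType) (P : probability T R)
    (omega : nat * nat -> {RV P >-> R}) : Prop :=
  mutually_independent quadrant omega /\
  forall z, quadrant z -> has_exponential_law 1 (omega z).

Definition weights_at (d : measure_display) (T : measurableType d)
    (R : realType) (P : probability T R) (omega : nat * nat -> {RV P >-> R})
    (t : T) : nat * nat -> R := fun z => omega z t.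

(* Main.v *)
Require Import Defs.
From HB Require Import structures.
From mathcomp Require Import all_boot all_order all_algebra finmap.
From mathcomp Require Import all_classical all_reals all_analysis.
From mathcomp Require Import measurable_realfun.
From mathcomp Require Import zify ring lra.
Set Implicit Arguments.
Unset Strict Implicit.
Unset Printing Implicit Defensive.
Import Order.TTheory GRing.Theory Num.Theory.
Import numFieldNormedType.Exports.
Local Open Scope classical_set_scope.
Local Open Scope ring_scope.

(** Looking backwards from the point (k + 1, n - k + 1), the event that the
    interface at time n has abscissa at most k is the event that the geodesic from
    (1, 1) to that point starts with a horizontal step.  After reflecting the
    environment this compares the two last-passage values at the neighbours of
    the far corner, that is, a horizontal increment I and a vertical increment J
    of last-passage values at one and the same point ([first_steps_reflected],
    [phi_hor_le], [phi_ver_le]).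

    Put independent exponential weights of rates w and 1 - w on the two axes of
    the quadrant.  Then I and J become independent exponentials of rates w and
    1 - w, so that I <= J with probability exactly w ([from_left_stationary]).
    This is Burke's property: each unit cell turns its two incoming increments
    and its weight into two outgoing increments and a dual weight by an
    involution preserving the product law ([exp1_cell], [stationary_cell]).
    If the geodesic to the corner leaves the boundary through the vertical axis,
    then removing the boundary can only increase I and decrease J, so the event
    I <= J without boundary has probability at most w plus the probability of an
    exit through the horizontal axis ([steps_left_zero_axes], [from_left_bulk]).

    The direction (x, 1 - x) is characteristic for the parameter
    zeta = sqrt x / (sqrt x + sqrt (1 - x)), and the point is to show that for
    w = zeta + e a horizontal exit has probability at most
    exp (1 - n e ^ 3 / 10).  Tilt the stationary law by exp (a (I_1 + ... + I_M)),
    where the I_i are the increments along the far horizontal side.  In the dual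
    coordinates these are independent and a horizontal exit is an increasing
    event in them, so tilting can only make it more likely, relatively to the
    total mass ([exits_hor_sweep], [exits_hor_le_tilt]).  In the original
    coordinates the tilting factor is exp (a G) times a product over the vertical
    axis, where G is the last-passage value.  On a horizontal exit, G does not see
    the vertical axis and increases with the weights of the horizontal one,
    so that all boundary parameters may be replaced by better ones; the
    exponential moment of G with boundary is explicit ([exp_moment_lpp]).
    The resulting bound [Ex_exits_hor_le] is optimised in [exit_bound_le].

    With e = 3 (log n / n)^(1/3) the exit probability is of order 1 / n, which
    gives the upper bound zeta + O (e).  Exchanging the two axes bounds the
    complementary event in the same way by 1 - zeta + O (e). *)

(** * Last-passage recursion and backward paths *)

(** The points on the axes carry boundary weights; the origin belongs to both. *)
Fixpoint lpp (R : realType) (v : nat * nat -> R) (i : nat) : nat -> R :=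
  fix lppi (j : nat) : R :=
    match i, j with
    | 0%N, 0%N => v (0%N, 0%N)
    | i'.+1, 0%N => v (i, 0%N) + lpp v i' 0
    | 0%N, j'.+1 => v (0%N, j) + lppi j'
    | i'.+1, j'.+1 => v (i, j) + Num.max (lpp v i' j) (lppi j')
    end.

(** The backward path from (i, j) steps left where b holds and down elsewhere, until it
    meets an axis: the value is true on the horizontal axis and false on the vertical one,
    the origin included. *)
Fixpoint exits_hor (b : nat -> nat -> bool) (i : nat) : nat -> bool :=
  fix exitsi (j : nat) : bool :=
    match i, j with
    | 0%N, _ => false
    | _.+1, 0%N => true
    | i'.+1, j'.+1 => if b i j then exits_hor b i' j else exitsi j'
    end.

Arguments lpp : simpl never.
Arguments exits_hor : simpl never.

Definition steps_left (R : realType) (v : nat * nat -> R) (i j : nat) : bool :=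
  lpp v i j.-1 < lpp v i.-1 j.

Section backward_paths.
Variable b : nat -> nat -> bool.

Lemma exits_horSS i j : exits_hor b i.+1 j.+1 =
  if b i.+1 j.+1 then exits_hor b i j.+1 else exits_hor b i.+1 j.
Proof. by []. Qed.

Lemma exits_hor0j j : exits_hor b 0 j = false.
Proof. by case: j. Qed.

Lemma exits_hori0 i : exits_hor b i.+1 0 = true.
Proof. by []. Qed.

(** Backward paths in the same field of directions merge when they meet, so they cannot
    cross: a path starting lower and further right exits further right. *)
Lemma exits_hor_antidiag i j : exits_hor b i j.+1 -> exits_hor b i.+1 j.
Proof.
have [n] := ubnP (i + j); elim: n i j => // n IH [|i] [|j] ltn.
- by rewrite exits_hor0j.
- by rewrite exits_hor0j.
- by rewrite exits_hori0.
move=> h.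
have h1 : exits_hor b i.+1 j.+1.
  move: h; rewrite exits_horSS; case: ifP => _ // h.
  by apply: IH h; lia.
rewrite exits_horSS; case: ifP => _ //.
by apply: IH h1; lia.
Qed.

Lemma exits_hor_antidiagD i j k : exits_hor b i (j + k) -> exits_hor b (i + k) j.
Proof.
elim: k i => [|k IH] i; first by rewrite !addn0.
rewrite addnS => /exits_hor_antidiag /IH; by rewrite addSnnS.
Qed.

End backward_paths.

(** The paths for the two fields may separate where b holds and b' does not; there the second
    path is the lower one, and by planarity it stays so. *)
Lemma exits_hor_antimono (b b' : nat -> nat -> bool) M N :
  (forall i j, (0 < i <= M)%N -> (0 < j <= N)%N -> b' i j -> b i j) ->
  exits_hor b M N -> exits_hor b' M N.
Proof.
have [n] := ubnP (M + N); elim: n M N => // n IH [|M] [|N] ltn bb.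
- by rewrite exits_hor0j.
- by rewrite exits_hor0j.
- by [].
have bb1 : exits_hor b M N.+1 -> exits_hor b' M N.+1.
  by apply: IH => [|i j Hi Hj]; [lia|apply: bb; lia].
have bb2 : exits_hor b M.+1 N -> exits_hor b' M.+1 N.
  by apply: IH => [|i j Hi Hj]; [lia|apply: bb; lia].
rewrite !exits_horSS; case: ifP => bMN; case: ifP => b'MN //.
- by move=> /exits_hor_antidiag /bb2.
- by move: bMN; rewrite bb //; lia.
Qed.

Section lpp_theory.
Variable R : realType.
Implicit Types v : nat * nat -> R.

Lemma lpp00 v : lpp v 0 0 = v (0, 0)%N.
Proof. by []. Qed.

Lemma lppS0 v i : lpp v i.+1 0 = v (i.+1, 0)%N + lpp v i 0.
Proof. by []. Qed.

Lemma lpp0S v j : lpp v 0 j.+1 = v (0, j.+1)%N + lpp v 0 j.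
Proof. by []. Qed.

Lemma lppSS v i j : lpp v i.+1 j.+1 =
  v (i.+1, j.+1)%N + Num.max (lpp v i j.+1) (lpp v i.+1 j).
Proof. by []. Qed.

Lemma lpp_local v v' M N :
  (forall z, (z.1 <= M)%N -> (z.2 <= N)%N -> v z = v' z) ->
  lpp v M N = lpp v' M N.
Proof.
have [n] := ubnP (M + N); elim: n M N => // n IH [|M] [|N] ltn vv'.
- by rewrite !lpp00 vv'.
- by rewrite !lpp0S vv' // (IH 0%N N) // => z ? ?; apply: vv' => //; lia.
- by rewrite !lppS0 vv' // (IH M 0%N) // => z ? ?; apply: vv' => //; lia.
have h1 : lpp v M N.+1 = lpp v' M N.+1.
  by apply: IH => [|z ? ?]; [lia|apply: vv' => //=; lia].
have h2 : lpp v M.+1 N = lpp v' M.+1 N.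
  by apply: IH => [|z ? ?]; [lia|apply: vv' => //=; lia].
by rewrite !lppSS vv' // h1 h2.
Qed.

Lemma ler_lpp v v' M N :
  (forall z, (z.1 <= M)%N -> (z.2 <= N)%N -> v z <= v' z) ->
  lpp v M N <= lpp v' M N.
Proof.
have [n] := ubnP (M + N); elim: n M N => // n IH [|M] [|N] ltn vv'.
- by rewrite !lpp00 vv'.
- by rewrite !lpp0S lerD ?vv' ?IH // => z ? ?; apply: vv' => //; lia.
- by rewrite !lppS0 lerD ?vv' ?IH // => z ? ?; apply: vv' => //; lia.
rewrite !lppSS lerD ?vv' //.
have h1 : lpp v M N.+1 <= lpp v' M N.+1.
  by apply: IH => [|z ? ?]; [lia|apply: vv' => //=; lia].
have h2 : lpp v M.+1 N <= lpp v' M.+1 N.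
  by apply: IH => [|z ? ?]; [lia|apply: vv' => //=; lia].
by rewrite ge_max !le_max h1 h2 orbT.
Qed.

Lemma lpp_ge0 v M N :
  (forall z, (z.1 <= M)%N -> (z.2 <= N)%N -> 0 <= v z) -> 0 <= lpp v M N.
Proof.
move=> v0; suff -> : 0 = lpp (fun=> 0 : R) M N by apply: ler_lpp.
have [n] := ubnP (M + N); elim: n M N {v0} => // n IH [|M] [|N] ltn //.
- by rewrite lpp0S -IH ?addr0 //; lia.
- by rewrite lppS0 -IH ?addr0 //; lia.
- by rewrite lppSS -!IH ?maxxx ?addr0 //; lia.
Qed.

(** Along a backward path that leaves through the horizontal axis only the
    weights of that axis and of the bulk are collected, so the vertical axis of
    the larger environment is free. *)
Lemma ler_lpp_exits_hor v v' M N :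
  (forall i, (i <= M)%N -> v (i, 0)%N <= v' (i, 0)%N) ->
  (forall i j, (0 < i <= M)%N -> (0 < j <= N)%N -> v (i, j) <= v' (i, j)) ->
  exits_hor (steps_left v) M N -> lpp v M N <= lpp v' M N.
Proof.
move=> hor bulk.
have axis i : (i <= M)%N -> lpp v i 0 <= lpp v' i 0.
  elim: i => [|i IH] iM; first by rewrite !lpp00 hor.
  by rewrite !lppS0 lerD ?hor ?IH //; lia.
suff : forall i j, (i <= M)%N -> (j <= N)%N ->
  exits_hor (steps_left v) i j -> lpp v i j <= lpp v' i j by apply.
move=> i j; have [n] := ubnP (i + j).
elim: n i j => // n IH [|i] [|j] ltn iM jN.
- by rewrite exits_hor0j.
- by rewrite exits_hor0j.
- by move=> _; apply: axis.
rewrite exits_horSS !lppSS; case: ifPn => [|]; rewrite /steps_left /= => lt h.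
  rewrite (max_l (ltW lt)) lerD //; first by apply: bulk; lia.
  by rewrite le_max IH //; lia.
rewrite -leNgt in lt; rewrite (max_r lt) lerD //; first by apply: bulk; lia.
by rewrite le_max; apply/orP; right; apply: IH => //; lia.
Qed.

Lemma ler_lpp_exits_ver v v' M N :
  (forall j, (j <= N)%N -> v (0, j)%N <= v' (0, j)%N) ->
  (forall i j, (0 < i <= M)%N -> (0 < j <= N)%N -> v (i, j) <= v' (i, j)) ->
  ~~ exits_hor (steps_left v) M N -> lpp v M N <= lpp v' M N.
Proof.
move=> ver bulk.
have axis j : (j <= N)%N -> lpp v 0 j <= lpp v' 0 j.
  elim: j => [|j IH] jN; first by rewrite !lpp00 ver.
  by rewrite !lpp0S lerD ?ver ?IH //; lia.
suff : forall i j, (i <= M)%N -> (j <= N)%N ->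
  ~~ exits_hor (steps_left v) i j -> lpp v i j <= lpp v' i j by apply.
move=> i j; have [n] := ubnP (i + j).
elim: n i j => // n IH [|i] [|j] ltn iM jN.
- by move=> _; apply: axis.
- by move=> _; apply: axis.
- by rewrite exits_hori0.
rewrite exits_horSS !lppSS; case: ifPn => [|]; rewrite /steps_left /= => lt h.
  rewrite (max_l (ltW lt)) lerD //; first by apply: bulk; lia.
  by rewrite le_max IH //; lia.
rewrite -leNgt in lt; rewrite (max_r lt) lerD //; first by apply: bulk; lia.
by rewrite le_max; apply/orP; right; apply: IH => //; lia.
Qed.

(** The increments I from below and J from the left of a cell of weight w become
    w + max (I - J) 0 and w + max (J - I) 0, which are nondecreasing in their own argument
    and nonincreasing in the other one, so the order on the axes propagates. *)
Lemma lpp_increments v v' M N :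
  (forall i, (0 < i <= M)%N -> v (i, 0)%N <= v' (i, 0)%N) ->
  (forall j, (0 < j <= N)%N -> v' (0, j)%N <= v (0, j)%N) ->
  (forall i j, (0 < i <= M)%N -> (0 < j <= N)%N -> v (i, j) = v' (i, j)) ->
  (forall i j, (i < M)%N -> (j <= N)%N ->
    lpp v i.+1 j - lpp v i j <= lpp v' i.+1 j - lpp v' i j) /\
  (forall i j, (i <= M)%N -> (j < N)%N ->
    lpp v' i j.+1 - lpp v' i j <= lpp v i j.+1 - lpp v i j).
Proof.
move=> hor ver bulk.
suff H : forall n i j, (i + j < n)%N ->
  ((i < M)%N -> (j <= N)%N ->
    lpp v i.+1 j - lpp v i j <= lpp v' i.+1 j - lpp v' i j) /\
  ((i <= M)%N -> (j < N)%N ->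
    lpp v' i j.+1 - lpp v' i j <= lpp v i j.+1 - lpp v i j).
  by split=> i j; have [] := H (i + j).+1 i j (ltnSn _).
elim=> // n IH i j ltn; split.
  case: j ltn => [|j] ltn iM jN.
    by rewrite !lppS0 !addrK hor.
  have [h1 _] := IH i j ltac:(lia); have {}h1 := h1 iM (ltnW jN).
  have [_ h2] := IH i j ltac:(lia); have {}h2 := h2 (ltnW iM) jN.
  rewrite !lppSS bulk //; move: (v' _) h1 h2 => t h1 h2.
  by case: (leP (lpp v i j.+1)) => ?; case: (leP (lpp v' i j.+1)) => ?; lra.
case: i ltn => [|i] ltn iM jN.
  by rewrite !lpp0S !addrK ver.
have [h1 _] := IH i j ltac:(lia); have {}h1 := h1 iM (ltnW jN).
have [_ h2] := IH i j ltac:(lia); have {}h2 := h2 (ltnW iM) jN.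
rewrite !lppSS bulk //; move: (v' _) h1 h2 => t h1 h2.
by case: (leP (lpp v i j.+1)) => ?; case: (leP (lpp v' i j.+1)) => ?; lra.
Qed.

Definition zero_axes v : nat * nat -> R :=
  fun z => if (z.1 == 0%N) || (z.2 == 0%N) then 0 else v z.

Definition zero_hor v : nat * nat -> R :=
  fun z => if z.2 == 0%N then 0 else v z.

(** If the optimal path of the environment with boundary uses the vertical axis
    and arrives from below, then it still does so without the horizontal axis,
    and removing the vertical axis as well only favours arrival from below. *)
Lemma steps_left_zero_axes v M N :
  (forall z, 0 <= v z) -> v (0, 0)%N = 0 ->
  lpp (zero_axes v) M.+1 N <= lpp (zero_axes v) M N.+1 ->
  exits_hor (steps_left v) M.+1 N.+1 || (lpp v M.+1 N <= lpp v M N.+1).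
Proof.
move=> v0 v00; apply: contraTT; rewrite negb_or -!ltNge => /andP[ver lt].
have ver' : ~~ exits_hor (steps_left v) M.+1 N.
  by move: ver; rewrite exits_horSS ifN // /steps_left /= -leNgt ltW.
have e1 : lpp v M.+1 N <= lpp (zero_hor v) M.+1 N.
  apply: ler_lpp_exits_ver ver' => [[|j] _|i [|j] _ //] //.
  by rewrite /zero_hor /= v00.
have e2 : lpp (zero_hor v) M N.+1 <= lpp v M N.+1.
  by apply: ler_lpp => z _ _; rewrite /zero_hor; case: ifP.
have [h1 h2] : _ /\ _ := @lpp_increments (zero_hor v) (zero_axes v) M.+1 N.+1
  ltac:(by move=> [|i] // _) ltac:(by move=> [|j] // _; apply: v0)
  ltac:(by move=> [|i] // [|j] //).
have {}h1 := h1 M N (ltnSn _) (leqnSn _).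
have {}h2 := h2 M N (leqnSn _) (ltnSn _).
lra.
Qed.

End lpp_theory.

(** * The cell involution *)

Section cells.
Variable R : realType.
Implicit Types (v u : nat * nat -> R) (c z : nat * nat) (cs : seq (nat * nat)).

(** Outgoing increments and dual weight of a cell, stored in place of the incoming
    increments and of the weight: the axis entries of the row and of the column of the cell
    serve as registers for the current increments.  With this storage the map is an
    involution. *)
Definition cell c v : nat * nat -> R := fun z =>
  let h := v (c.1, 0)%N in let k := v (0, c.2)%N in
  if z == (c.1, 0)%N then v c + h - Num.min h k else
  if z == (0, c.2)%N then v c + k - Num.min h k else
  if z == c then Num.min h k else v z.

Definition inner c := (0 < c.1)%N && (0 < c.2)%N.

Lemma cell_hor c v : cell c v (c.1, 0)%N =
  v c + v (c.1, 0)%N - Num.min (v (c.1, 0)%N) (v (0, c.2)%N).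
Proof. by rewrite /cell eqxx. Qed.

Lemma cell_ver c v : inner c -> cell c v (0, c.2)%N =
  v c + v (0, c.2)%N - Num.min (v (c.1, 0)%N) (v (0, c.2)%N).
Proof.
move=> /andP[c1 c2]; rewrite /cell eqxx ifF //.
by apply/negbTE; rewrite xpair_eqE; lia.
Qed.

Lemma cell_bulk c v : inner c -> cell c v c =
  Num.min (v (c.1, 0)%N) (v (0, c.2)%N).
Proof.
case: c => i j /andP[/= c1 c2]; rewrite /cell eqxx /= !ifF //.
  by apply/negbTE; rewrite xpair_eqE; lia.
by apply/negbTE; rewrite xpair_eqE; lia.
Qed.

Lemma cell_id c v z : z != (c.1, 0)%N -> z != (0, c.2)%N -> z != c ->
  cell c v z = v z.
Proof. by rewrite /cell => /negbTE-> /negbTE-> /negbTE->. Qed.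

Lemma cellK c v : inner c -> cell c (cell c v) = v.
Proof.
move=> ic; apply/funext => z; rewrite {1}/cell cell_hor cell_ver // cell_bulk //.
set h := v (c.1, _); set k := v (0%N, _).
have -> : Num.min (v c + h - Num.min h k) (v c + k - Num.min h k) = v c.
  by rewrite /Num.min; case: (ltP h k) => ?; case: ifP => ?; lra.
case: eqP => [->|/eqP n1]; first by rewrite -/h; lra.
case: eqP => [->|/eqP n2]; first by rewrite -/k; lra.
by case: eqP => [->|/eqP n3] //; rewrite cell_id.
Qed.

Definition sweep cs v := foldl (fun u c => cell c u) v cs.

Lemma sweep_cat cs1 cs2 v : sweep (cs1 ++ cs2) v = sweep cs2 (sweep cs1 v).
Proof. by rewrite /sweep foldl_cat. Qed.

Lemma sweep_rcons cs c v : sweep (rcons cs c) v = cell c (sweep cs v).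
Proof. by rewrite -cats1 sweep_cat. Qed.

Lemma sweepK cs v : all inner cs -> sweep (rev cs) (sweep cs v) = v.
Proof.
elim/last_ind: cs v => // cs c IH v; rewrite all_rcons => /andP[ic ics].
by rewrite rev_rcons sweep_rcons /= cellK // IH.
Qed.

Lemma sweep_revK cs v : all inner cs -> sweep cs (sweep (rev cs) v) = v.
Proof.
by move=> ics; rewrite -{1}[cs]revK sweepK // all_rev.
Qed.

(** Undoing a cell is monotone in the two increments but restores a weight that is not, which
    is why equality is only required on the cells that remain to be undone. *)
Definition hor_le cs u u' :=
  [/\ forall i, (0 < i)%N -> u (i, 0)%N <= u' (i, 0)%N,
      forall j, (0 < j)%N -> u' (0, j)%N <= u (0, j)%N &
      forall z, z \in cs -> u z = u' z].

Lemma hor_le_cell cs c u u' : all inner (rcons cs c) -> uniq (rcons cs c) ->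
  hor_le (rcons cs c) u u' -> hor_le cs (cell c u) (cell c u').
Proof.
case: c => k l; rewrite all_rcons rcons_uniq => /andP[ic ics] /andP[ncs _] [hor ver bulk].
have /andP[/= c1 c2] := ic.
have h1 := hor _ c1; have h2 := ver _ c2.
have h3 : u (k, l) = u' (k, l) by apply: bulk; rewrite mem_rcons mem_head.
split.
- move=> i i0; have [->|ne] := eqVneq i k.
    rewrite !(cell_hor (k, l)) /= h3; move: h1 h2.
    move: (u _) (u _) (u' _) (u' _) (u' _) => a b a' b' d h1 h2.
    by rewrite /Num.min; case: ifP => ?; case: ifP => ?; lra.
  by rewrite !cell_id ?hor // xpair_eqE /=; lia.
- move=> j j0; have [->|ne] := eqVneq j l.
    rewrite !(@cell_ver (k, l)) //= h3; move: h1 h2.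
    move: (u _) (u _) (u' _) (u' _) (u' _) => a b a' b' d h1 h2.
    by rewrite /Num.min; case: ifP => ?; case: ifP => ?; lra.
  by rewrite !cell_id ?ver // xpair_eqE /=; lia.
- move=> [i j] zcs; have /andP[/= z1 z2] := allP ics _ zcs.
  have zc : (i, j) != (k, l) by apply/eqP => zc; rewrite -zc zcs in ncs.
  rewrite !cell_id ?xpair_eqE //=; try lia.
  by rewrite bulk // mem_rcons inE zcs orbT.
Qed.

Lemma hor_le_sweep cs1 cs2 v v' : all inner (cs1 ++ cs2) -> uniq (cs1 ++ cs2) ->
  hor_le (cs1 ++ cs2) (sweep (cs1 ++ cs2) v) (sweep (cs1 ++ cs2) v') ->
  hor_le cs1 (sweep cs1 v) (sweep cs1 v').
Proof.
elim: cs2 cs1 => [|c cs2 IH] cs1; first by rewrite cats0.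
rewrite -cat_rcons => ics ucs /(IH _ ics ucs); rewrite !sweep_rcons => h.
have ic : all inner (rcons cs1 c) by move: ics; rewrite all_cat => /andP[].
have := hor_le_cell ic _ h; rewrite !cellK; last 2 first.
- by move: ic; rewrite all_rcons => /andP[].
- by move: ic; rewrite all_rcons => /andP[].
by apply; move: ucs; rewrite cat_uniq => /andP[].
Qed.

End cells.

Section grid.
Variable R : realType.
Implicit Types (v u : nat * nat -> R).

Definition grid M N : seq (nat * nat) :=
  [seq (i, j) | j <- iota 1 N, i <- iota 1 M].

Lemma iota1S n : iota 1 n.+1 = rcons (iota 1 n) n.+1.
Proof. by rewrite -cats1 -[in iota 1 _](addn1 n) iotaD add1n. Qed.

Definition partial_grid M n m := grid M n ++ [seq (i, n.+1) | i <- iota 1 m].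

Lemma gridS M N : grid M N.+1 = partial_grid M N M.
Proof.
by rewrite /partial_grid /grid iota1S -cats1 allpairs_cat /= cats0.
Qed.

Lemma partial_gridS M n m :
  partial_grid M n m.+1 = rcons (partial_grid M n m) (m.+1, n.+1).
Proof. by rewrite /partial_grid iota1S map_rcons rcons_cat. Qed.

Lemma partial_grid0 M n : partial_grid M n 0 = grid M n.
Proof. by rewrite /partial_grid cats0. Qed.

Lemma inner_grid M N : all inner (grid M N).
Proof.
by apply/allP => z /allpairsP[[j i] /= [+ + ->]]; rewrite !mem_iota /inner /=; lia.
Qed.

Lemma uniq_grid M N : uniq (grid M N).
Proof.
apply: allpairs_uniq; rewrite ?iota_uniq //.
by move=> [a b] [c d] _ _ /= [-> ->].
Qed.

Lemma grid_prefix M N i j : (i <= M)%N -> (j < N)%N ->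
  exists cs, grid M N = partial_grid M j i ++ cs.
Proof.
move=> iM jN.
exists ([seq (k, j.+1) | k <- iota i.+1 (M - i)] ++
        [seq (k, l) | l <- iota j.+2 (N - j.+1), k <- iota 1 M]).
rewrite /partial_grid catA -(catA (grid M j)) -map_cat -(iotaD 1) subnKC //.
rewrite -/(partial_grid M j M) -gridS /grid -allpairs_cat.
by rewrite -(iotaD 1) subnKC.
Qed.

(** Row by row, the axes hold the increments of the last-passage function along
    the boundary of the region swept so far. *)
Definition swept v M n m u :=
  [/\ forall i, (0 < i <= m)%N -> u (i, 0)%N = lpp v i n.+1 - lpp v i.-1 n.+1,
      forall i, (m < i <= M)%N -> u (i, 0)%N = lpp v i n - lpp v i.-1 n,
      forall j, (0 < j <= n)%N -> u (0, j)%N = lpp v M j - lpp v M j.-1,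
      u (0, n.+1)%N = lpp v m n.+1 - lpp v m n &
      (forall j, (n.+1 < j)%N -> u (0, j)%N = v (0, j)%N) /\
      (forall i j, (0 < i)%N -> (n.+1 < j)%N || ((j == n.+1) && (m < i)%N) ->
         u (i, j) = v (i, j))].

Lemma swept_cell v M n m u : (m < M)%N ->
  swept v M n m u -> swept v M n m.+1 (cell (m.+1, n.+1) u).
Proof.
move=> mM [s1 s2 s3 s4 [s5 s6]].
have eh : u (m.+1, 0)%N = lpp v m.+1 n - lpp v m n by apply: s2; lia.
have ew : u (m.+1, n.+1) = v (m.+1, n.+1) by apply: s6 => //; lia.
have ch := cell_hor (m.+1, n.+1) u.
have cv := @cell_ver _ (m.+1, n.+1) u isT.
rewrite /= eh s4 ew in ch cv.
split.
- move=> i iM; have [->|ne] := eqVneq i m.+1.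
    rewrite ch /= lppSS; case: leP => ?; case: leP => ?; lra.
  by rewrite cell_id ?s1 ?xpair_eqE //=; lia.
- by move=> i iM; rewrite cell_id ?s2 ?xpair_eqE //=; lia.
- by move=> j jn; rewrite cell_id ?s3 ?xpair_eqE //=; lia.
- rewrite cv /= lppSS; case: leP => ?; case: leP => ?; lra.
- split=> [j jn|i j i0 jn].
    by rewrite cell_id ?s5 ?xpair_eqE //=; lia.
  by rewrite cell_id ?s6 ?xpair_eqE //=; lia.
Qed.

Lemma swept_row v M n u : swept v M n M u -> swept v M n.+1 0 u.
Proof.
move=> [s1 s2 s3 s4 [s5 s6]]; split.
- by move=> i; lia.
- by move=> i iM; rewrite s1 //; lia.
- move=> j jn; have [->|ne] := eqVneq j n.+1; first by rewrite s4.
  by rewrite s3 //; lia.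
- by rewrite s5 // lpp0S addrK.
- by split=> [j jn|i j i0 jn]; rewrite ?s5 ?s6 //; lia.
Qed.

Lemma swept_partial_grid v M n m : (m <= M)%N ->
  swept v M n m (sweep (partial_grid M n m) v).
Proof.
elim: n m => [|n IH].
  elim=> [|m IHm] mM; last first.
    by rewrite partial_gridS sweep_rcons; apply/swept_cell/IHm => //; lia.
  rewrite partial_grid0 /grid /=; split.
  - by move=> i; lia.
  - by move=> [|i] // _; rewrite lppS0 addrK.
  - by move=> j; lia.
  - by rewrite lpp0S addrK.
  - by [].
elim=> [|m IHm] mM; last first.
  by rewrite partial_gridS sweep_rcons; apply/swept_cell/IHm => //; lia.
by rewrite partial_grid0 gridS; apply/swept_row/IH.
Qed.

Lemma sweep_grid v M N :
  (forall i, (0 < i <= M)%N ->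
     sweep (grid M N) v (i, 0)%N = lpp v i N - lpp v i.-1 N) /\
  (forall j, (0 < j <= N)%N ->
     sweep (grid M N) v (0, j)%N = lpp v M j - lpp v M j.-1).
Proof.
by rewrite -partial_grid0; have [] := @swept_partial_grid v M N 0 isT.
Qed.

(** Undoing the cells in reverse order transports the order: larger horizontal
    increments and smaller vertical ones turn left steps of backward paths into
    down steps. *)
Lemma exits_hor_sweep v v' M N :
  hor_le (grid M N) (sweep (grid M N) v) (sweep (grid M N) v') ->
  exits_hor (steps_left v) M N -> exits_hor (steps_left v') M N.
Proof.
move=> h; apply: exits_hor_antimono => i [|j] //; case: i => // i iM jN.
have [cs E] := @grid_prefix M N i.+1 j iM jN.
have := @hor_le_sweep _ (partial_grid M j i.+1) cs v v'.
rewrite -E => /(_ (inner_grid _ _) (uniq_grid _ _) h)[h1 h2 _].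
have {h1}:= h1 i.+1 isT; have {h2}:= h2 j.+1 isT.
have [p1 _ _ -> _] := @swept_partial_grid v M j i.+1 iM.
have [p1' _ _ -> _] := @swept_partial_grid v' M j i.+1 iM.
rewrite p1 ?p1' ?ltnSn // /steps_left /=; lra.
Qed.

Definition haxis M : seq (nat * nat) := [seq (i, 0)%N | i <- iota 1 M].
Definition vaxis N : seq (nat * nat) := [seq (0, j)%N | j <- iota 1 N].

(** Telescoping along the far horizontal side. *)
Lemma sum_haxis_sweep v M N : v (0, 0)%N = 0 ->
  \sum_(z <- haxis M) sweep (grid M N) v z =
  lpp v M N - \sum_(z <- vaxis N) v z.
Proof.
move=> v00.
have -> : \sum_(z <- vaxis N) v z = lpp v 0 N.
  rewrite /vaxis big_map; elim: N => [|N IH]; first by rewrite big_nil lpp00.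
  by rewrite iota1S big_rcons /= IH lpp0S addrC.
rewrite /haxis big_map.
have [H _] := sweep_grid v M N; move: H.
suff E : forall m, (m <= M)%N -> (forall i, (0 < i <= M)%N ->
     sweep (grid M N) v (i, 0)%N = lpp v i N - lpp v i.-1 N) ->
  \sum_(i <- iota 1 m) sweep (grid M N) v (i, 0)%N = lpp v m N - lpp v 0 N.
  exact: E.
elim=> [|m IH] mM H; first by rewrite big_nil subrr.
by rewrite iota1S big_rcons /= IH ?H ?mM //=; [lra|exact: ltnW].
Qed.

End grid.

(** * Exponential integrals *)

Section density.
Context d (T : measurableType d) (R : realType).
Variables (mu nu : {measure set T -> \bar R}) (g : T -> R).
Hypothesis mg : measurable_fun setT g.
Hypothesis g0 : forall x, 0 <= g x.
Hypothesis nuE : forall A, measurable A ->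
  nu A = (\int[mu]_(x in A) (g x)%:E)%E.

Import HBNNSimple.
Local Open Scope ereal_scope.

Let density_nnsfun (h : {nnsfun T >-> R}) :
  \int[nu]_x (h x)%:E = \int[mu]_x ((h x)%:E * (g x)%:E).
Proof.
have mgE : measurable_fun setT (fun x => (g x)%:E) by exact/measurable_EFinP.
under eq_integral do rewrite fimfunE -fsumEFin//.
under [RHS]eq_integral do rewrite fimfunE -fsumEFin// muleC.
rewrite ge0_integral_fsum//; last 2 first.
- by move=> r; apply/measurable_EFinP; exact: measurable_funM.
- by move=> r x _; rewrite nnfun_muleindic_ge0.
under [RHS]eq_integral => x _.
  rewrite ge0_mule_fsumr; last by move=> r; exact: nnfun_muleindic_ge0.
  over.
rewrite [RHS]ge0_integral_fsum//; last 2 first.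
- move=> r; apply: emeasurable_funM => //.
  by apply/measurable_EFinP; exact: measurable_funM.
- move=> r x _; apply: mule_ge0; first by rewrite lee_fin.
  by rewrite EFinM nnfun_muleindic_ge0.
apply: eq_fsbigr => r _; rewrite integralZl_indic_nnsfun// integral_indic//=.
rewrite setIT nuE//.
rewrite [in RHS](eq_integral
    (fun x => r%:E * ((\1_(h @^-1` [set r]) x)%:E * (g x)%:E))); last first.
  by move=> x _; rewrite EFinM muleC muleA.
have [r0|r0] := leP 0%R r.
  rewrite ge0_integralZl//.
  - congr (_ * _); rewrite integral_mkcond; apply: eq_integral => x _.
    by rewrite patchE indicE; case: ifPn; rewrite ?mul1e ?mul0e.
  - by apply: emeasurable_funM => //; exact/measurable_EFinP.
  - by move=> x _; rewrite mule_ge0 ?lee_fin.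
rewrite preimage_nnfun0// integral_set0 mule0 integral0_eq// => x _.
by rewrite indic0 mul0e mule0.
Qed.

Lemma ge0_integral_density (f : T -> \bar R) : measurable_fun setT f ->
  (forall x, 0 <= f x) -> \int[nu]_x f x = \int[mu]_x (f x * (g x)%:E).
Proof.
move=> mf f0; pose f_ := nnsfun_approx measurableT mf.
have mgE : measurable_fun setT (fun x => (g x)%:E) by exact/measurable_EFinP.
transitivity (limn (fun n => \int[nu]_x (f_ n x)%:E)).
  rewrite -monotone_convergence//=.
  - apply: eq_integral => x _; apply/esym/cvg_lim => //=.
    exact: cvg_nnsfun_approx.
  - by move=> n; exact/measurable_EFinP.
  - by move=> n x _; rewrite lee_fin.
  - by move=> x _ m n mn; rewrite lee_fin; exact/lefP/nd_nnsfun_approx.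
under eq_fun do rewrite density_nnsfun.
rewrite -monotone_convergence//=.
- apply: eq_integral => x _; apply/cvg_lim => //=.
  by apply: cvgeZr => //; exact: cvg_nnsfun_approx.
- by move=> n; apply: emeasurable_funM => //; exact/measurable_EFinP.
- by move=> n x _; rewrite mule_ge0 ?lee_fin.
- move=> x _ m n mn; rewrite lee_pmul ?lee_fin//.
  exact/lefP/nd_nnsfun_approx.
Qed.

End density.

Lemma measurable_boolE (R : realType) d (T : measurableType d) (b : T -> bool) :
  measurable_fun setT b -> measurable_fun setT (fun t => ((b t)%:R : R)%:E).
Proof.
move=> mb; apply/measurable_EFinP.
rewrite (_ : (fun t => _) = (fun t => if b t then 1 else 0 : R)).
  exact: measurable_fun_ifT.
by apply/funext => t; case: (b t).
Qed.

Definition image_measure d d' (T1 : measurableType d) (T2 : measurableType d')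
    (R : realType) (m : {measure set T1 -> \bar R}) (f : T1 -> T2)
    (mf : measurable_fun setT f) : {measure set T2 -> \bar R} :=
  measure_function_pushforward__canonical__measure_function_Measure m mf.

Section affine_substitution.
Variable R : realType.
Local Notation mu := (@lebesgue_measure R).
Local Open Scope ereal_scope.

Let affine (c b : R) : measurableTypeR R -> measurableTypeR R :=
  fun x => (c * x + b)%R.

Let measurable_affine c b : measurable_fun setT (affine c b).
Proof. by apply: measurable_funD => //; exact: measurable_funM. Qed.

Let lebesgue_measure_affine (c b : R) (c0 : (0 < c)%R) A : measurable A ->
  pushforward mu (affine c b) A = c^-1%:E * mu A.
Proof.
move=> mA.
have c1 : (0 <= c)%R by exact: ltW.
pose m1 : {measure set (measurableTypeR R) -> \bar R} :=
  mscale (NngNum c1) (image_measure mu (@measurable_affine c b)).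
have -> : mu A = m1 A.
  apply: lebesgue_measure_unique => // _ [[x y]] _ <-.
  rewrite /m1/= /mscale/= /pushforward.
  have -> : affine c b @^-1` `]x, y]%classic =
      `]((x - b) / c)%R, ((y - b) / c)%R]%classic.
    apply/seteqP; split=> z /=; rewrite /affine !in_itv/=.
      by rewrite ltr_pdivrMr// ler_pdivlMr// ltrBlDr lerBrDr mulrC.
    by rewrite ltr_pdivrMr// ler_pdivlMr// ltrBlDr lerBrDr mulrC.
  rewrite !lebesgue_measure_itv/= !lte_fin ltr_pM2r ?invr_gt0// ltrD2r.
  case: ifPn => _; rewrite ?mule0// -!EFinD -EFinM; congr _%:E.
  by field; rewrite gt_eqF.
rewrite /m1/= /mscale/= muleA -EFinM mulVf ?mul1e//.
by rewrite gt_eqF.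
Qed.

Lemma ge0_integral_affine (c b : R) (f : R -> \bar R) : (0 < c)%R ->
  measurable_fun setT f -> (forall x, 0 <= f x) ->
  \int[mu]_x f (c * x + b)%R = c^-1%:E * \int[mu]_x f x.
Proof.
move=> c0 mf f0.
have c1 : (0 <= c^-1)%R by rewrite invr_ge0 ltW.
rewrite -[LHS]/(\int[mu]_(x in affine c b @^-1` setT) (f \o affine c b) x).
rewrite -(@ge0_integral_pushforward _ _ _ _ R (affine c b)) //.
rewrite (eq_measure_integral (mscale (NngNum c1) mu)); last first.
  by move=> A mA _; exact: lebesgue_measure_affine.
by rewrite ge0_integral_mscale.
Qed.

End affine_substitution.

Section exponential.
Variable R : realType.
Local Notation mu := (@lebesgue_measure R).
Local Open Scope ereal_scope.

Definition exp1 : probability (measurableTypeR R) R :=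
  exponential_distribution_exponential_prob__canonical__probability_measure_Probability
    ltr01.

Lemma measurable_pdf (r : R) : measurable_fun setT (fun x : R => (exponential_pdf r x)%:E).
Proof. by apply/measurable_EFinP; exact: measurable_exponential_pdf. Qed.

Lemma pdf_ge0 (r x : R) : (0 < r)%R -> 0 <= (@exponential_pdf R r x)%:E.
Proof. by move=> r0; rewrite lee_fin exponential_pdf_ge0// ltW. Qed.

Lemma exponential_pdf_scale (r x : R) : (0 < r)%R ->
  exponential_pdf r x = (r * exponential_pdf 1 (r * x))%R.
Proof.
move=> r0; have [x0|x0] := ltP x 0%R.
  by rewrite !lt0_exponential_pdf ?mulr0// pmulr_rlt0.
by rewrite !exponential_pdfE ?mulr_ge0 ?(ltW r0)// mul1r mulNr mulN1r.
Qed.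

Lemma integral_exp1_scale (r : R) (f : R -> \bar R) : (0 < r)%R ->
  measurable_fun setT f -> (forall x, 0 <= f x) ->
  \int[exp1]_x f (x / r)%R = \int[mu]_x (f x * (exponential_pdf r x)%:E).
Proof.
move=> r0 mf f0.
have mfr : measurable_fun setT (fun x : R => f (x / r)%R).
  by apply: measurableT_comp => //; exact: measurable_funM.
rewrite (@ge0_integral_density _ _ R mu exp1 (@exponential_pdf R 1)) //; last 2 first.
- exact: measurable_exponential_pdf.
- by move=> x; exact: exponential_pdf_ge0.
have -> : \int[mu]_x (f (x / r)%R * (exponential_pdf 1 x)%:E) =
    r%:E * \int[mu]_x (f ((r * x + 0) / r)%R * (exponential_pdf 1 (r * x + 0))%:E).
  rewrite (@ge0_integral_affine _ r 0
      (fun x => f (x / r)%R * (exponential_pdf 1 x)%:E)) //.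
  - by rewrite muleA -EFinM mulfV ?mul1e// gt_eqF.
  - by apply: emeasurable_funM => //; exact: measurable_pdf.
  - by move=> x; rewrite mule_ge0// pdf_ge0.
rewrite -ge0_integralZl//; last 3 first.
- apply: emeasurable_funM.
    by apply: (measurableT_comp mfr); apply: measurable_funD => //; exact: measurable_funM.
  apply: (measurableT_comp (measurable_pdf 1)).
  by apply: measurable_funD => //; exact: measurable_funM.
- by move=> x _; rewrite mule_ge0// pdf_ge0.
- by rewrite lee_fin ltW.
apply: eq_integral => x _; rewrite addr0 mulrAC divff ?gt_eqF// mul1r.
by rewrite (exponential_pdf_scale _ r0) EFinM muleCA.
Qed.

Lemma integral_exp1 (f : R -> \bar R) :
  measurable_fun setT f -> (forall x, 0 <= f x) ->
  \int[exp1]_x f x = \int[mu]_x (f x * (exponential_pdf 1 x)%:E).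
Proof.
move=> mf f0; rewrite -integral_exp1_scale//.
by apply: eq_integral => x _; rewrite divr1.
Qed.

(** A tilted exponential density is the density of another rate, and changing the rate of an
    exponential amounts to a dilation. *)
Lemma integral_exp1_tilt (c : R) (f : R -> \bar R) : (c < 1)%R ->
  measurable_fun setT f -> (forall x, 0 <= f x) ->
  \int[exp1]_x (f x * (expR (c * x))%:E) =
  (1 - c)^-1%:E * \int[exp1]_x f (x / (1 - c))%R.
Proof.
move=> c1 mf f0; have c0 : (0 < 1 - c)%R by rewrite subr_gt0.
have me : measurable_fun setT (fun x : R => (expR (c * x))%:E).
  apply/measurable_EFinP; apply: measurableT_comp => //; exact: measurable_funM.
rewrite integral_exp1//; last 2 first.
- exact: emeasurable_funM.
- by move=> x; rewrite mule_ge0// lee_fin expR_ge0.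
rewrite integral_exp1_scale// -ge0_integralZl//; last 3 first.
- by apply: emeasurable_funM => //; exact: measurable_pdf.
- by move=> x _; rewrite mule_ge0// pdf_ge0.
- by rewrite lee_fin invr_ge0 ltW.
apply: eq_integral => x _; rewrite muleCA -muleA -!EFinM; congr (_ * _%:E).
have [x0|x0] := ltP x 0%R.
  by rewrite !lt0_exponential_pdf ?mulr0.
rewrite !exponential_pdfE// mul1r mulrA mulVf ?gt_eqF// mul1r -expRD.
by congr expR; ring.
Qed.

Lemma exp1_lt0 : exp1 [set x | (x < 0)%R] = 0.
Proof.
rewrite -[LHS]/(\int[mu]_(x in _) _); apply: integral0_eq => x /= x0.
by rewrite lt0_exponential_pdf.
Qed.

Lemma exp1_set1 (a : R) : exp1 [set a] = 0.
Proof.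
rewrite -[LHS]/(\int[mu]_(x in _) _); apply: null_set_integral => //.
  by apply: measurable_funTS; exact: measurable_pdf.
exact: lebesgue_measure_set1.
Qed.

Lemma measurable_integral_exp1 d (T : measurableType d) (f : T * R -> \bar R) :
  measurable_fun setT f -> (forall z, 0 <= f z) ->
  measurable_fun setT (fun x => \int[exp1]_y f (x, y)).
Proof.
move=> mf f0; exact: (@measurable_fun_fubini_tonelli_F _ _ _ _ R exp1 f mf f0).
Qed.

Section memoryless.
Variables (r s : R) (r0 : (0 < r)%R) (s0 : (0 < s)%R) (rs : (r + s = 1)%R).
Variable g : R * R -> \bar R.
Hypothesis mg : measurable_fun setT g.
Hypothesis g0 : forall x, 0 <= g x.

Let h p q := g (p, q) * (exponential_pdf r p * exponential_pdf s q)%:E.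

Let h0 p q : 0 <= h p q.
Proof. by rewrite mule_ge0// lee_fin mulr_ge0// exponential_pdf_ge0// ltW. Qed.

Let mh : measurable_fun setT (fun z : R * R => h z.1 z.2).
Proof.
apply: emeasurable_funM.
  by apply: (measurableT_comp mg); apply: measurable_fun_pair.
apply/measurable_EFinP; apply: measurable_funM.
  by apply: (measurableT_comp (measurable_exponential_pdf r)).
by apply: (measurableT_comp (measurable_exponential_pdf s)).
Qed.

Let ind_le (z : R * R) : \bar R := ((z.2 <= z.1)%R%:R)%:E.

Let mind : measurable_fun setT ind_le.
Proof. by apply: measurable_boolE; exact: measurable_fun_ler. Qed.

Let mg2 (F : R * R -> R * R) : measurable_fun setT F ->
  measurable_fun setT (fun z => g (F z)).
Proof. exact: measurableT_comp. Qed.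

Let mgx : measurable_fun setT (fun z : R * R => g ((z.1 + z.2 / r)%R, z.1)).
Proof.
apply: mg2; apply: measurable_fun_pair => //; apply: measurable_funD => //.
exact: measurable_funM.
Qed.

(** Lack of memory: once the clock of rate s has rung first, at time q, the remaining time of
    the clock of rate r is again exponential of rate r.  As r + s = 1, the first ringing time
    has rate 1 whichever clock rings. *)
Lemma exp1_overshoot :
  \int[mu]_q \int[mu]_p (h p q * ind_le (p, q)) =
  s%:E * \int[exp1]_q \int[exp1]_x g ((q + x / r)%R, q).
Proof.
rewrite integral_exp1; last 2 first.
- exact: (measurable_integral_exp1 mgx (fun=> g0 _)).
- by move=> q; apply: integral_ge0.
rewrite -ge0_integralZl//; last 3 first.
- apply: emeasurable_funM; last exact: measurable_pdf.
  exact: (measurable_integral_exp1 mgx (fun=> g0 _)).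
- by move=> q _; rewrite mule_ge0 ?pdf_ge0//; apply: integral_ge0.
- by rewrite lee_fin ltW.
apply: eq_integral => q _.
have mgq : measurable_fun setT (fun p : R => g ((q + p)%R, q)).
  apply: measurableT_comp => //; apply: measurable_fun_pair => //.
  exact: measurable_funD.
rewrite (integral_exp1_scale r0 mgq)//.
rewrite muleCA [s%:E * _]muleC -ge0_integralZr//; last 3 first.
- by apply: emeasurable_funM => //; exact: measurable_pdf.
- by move=> p _; rewrite mule_ge0 ?pdf_ge0.
- by rewrite mule_ge0 ?pdf_ge0 ?lee_fin ?ltW.
have mhq : measurable_fun setT (fun p : R => h p q * ind_le (p, q)).
  apply: emeasurable_funM.
    by apply: (measurableT_comp mh (g := fun p => (p, q))); exact: measurable_fun_pair.
  by apply: (measurableT_comp mind (g := fun p => (p, q))); exact: measurable_fun_pair.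
have := @ge0_integral_affine _ 1 q _ ltr01 mhq.
rewrite invr1 mul1e => <-; last by move=> p; rewrite mule_ge0// lee_fin ler0n.
apply: eq_integral => p _; rewrite mul1r /h /ind_le/= lerDr [(p + q)%R]addrC.
rewrite -!muleA; congr (_ * _); rewrite -!EFinM; congr _%:E.
have [p0|p0] := leP 0%R p; last by rewrite !mulr0 lt0_exponential_pdf// mul0r.
have [q0|q0] := leP 0%R q; last first.
  by rewrite !(lt0_exponential_pdf _ q0) !(mulr0, mul0r).
rewrite !exponential_pdfE ?addr_ge0// mulr1 !mul1r.
have -> : (r * expR (- r * (q + p)) * (s * expR (- s * q)) =
  r * s * (expR (- r * (q + p)) * expR (- s * q)))%R by ring.
have -> : (r * expR (- r * p) * (expR (- 1 * q) * s) =
  r * s * (expR (- r * p) * expR (- 1 * q)))%R by ring.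
by rewrite -!expRD -rs; congr (_ * expR _)%R; ring.
Qed.

End memoryless.

End exponential.

Section race.
Variable R : realType.
Local Notation mu := (@lebesgue_measure R).
Local Notation exp1 := (exp1 R).
Local Open Scope ereal_scope.

(** Conditioning on which of the two clocks rings first. *)
Lemma exp1_race (r s : R) (g : R * R -> \bar R) : (0 < r)%R -> (0 < s)%R ->
  (r + s = 1)%R -> measurable_fun setT g -> (forall z, 0 <= g z) ->
  \int[exp1]_x \int[exp1]_y g ((x / r)%R, (y / s)%R) =
  s%:E * \int[exp1]_q \int[exp1]_x g ((q + x / r)%R, q) +
  r%:E * \int[exp1]_p \int[exp1]_y g (p, (p + y / s)%R).
Proof.
move=> r0 s0 rs mg g0.
pose h (z : R * R) := g z * (exponential_pdf r z.1 * exponential_pdf s z.2)%:E.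
have h0 z : 0 <= h z.
  by rewrite mule_ge0// lee_fin mulr_ge0// exponential_pdf_ge0// ltW.
have mh : measurable_fun setT h.
  apply: emeasurable_funM => //; apply/measurable_EFinP; apply: measurable_funM.
    by apply: (measurableT_comp (measurable_exponential_pdf r)).
  by apply: (measurableT_comp (measurable_exponential_pdf s)).
have sr : (s + r = 1)%R by rewrite addrC.
have mgs : measurable_fun setT (fun z : R * R => g (z.2, z.1)).
  by apply: measurableT_comp => //; exact: measurable_fun_pair.
have := exp1_overshoot s0 r0 sr mgs (fun=> g0 _).
move=> /= <-.
rewrite -(exp1_overshoot r0 s0 rs mg g0).
pose le1 (z : R * R) : \bar R := ((z.2 <= z.1)%R%:R)%:E.
pose lt2 (z : R * R) : \bar R := ((z.1 < z.2)%R%:R)%:E.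
have mle1 : measurable_fun setT le1.
  by apply: measurable_boolE; exact: measurable_fun_ler.
have mlt2 : measurable_fun setT lt2.
  by apply: measurable_boolE; exact: measurable_fun_ltr.
have pair1 (p : R) : measurable_fun setT (fun q : R => (p, q)) by exact: measurable_fun_pair.
have mhle : measurable_fun setT (fun z => h z * le1 z) by exact: emeasurable_funM.
have mhlt : measurable_fun setT (fun z => h z * lt2 z) by exact: emeasurable_funM.
have hle0 z : 0 <= h z * le1 z by rewrite mule_ge0// lee_fin ler0n.
have hlt0 z : 0 <= h z * lt2 z by rewrite mule_ge0// lee_fin ler0n.
have -> : \int[exp1]_x \int[exp1]_y g ((x / r)%R, (y / s)%R) =
    \int[mu]_p \int[mu]_q h (p, q).
  have mgy : measurable_fun setT (fun z : R * R => g (z.1, (z.2 / s)%R)).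
    apply: measurableT_comp => //; apply: measurable_fun_pair => //.
    exact: measurable_funM.
  rewrite (@integral_exp1_scale R r (fun x : R => \int[exp1]_y g (x, (y / s)%R)))//; last 2 first.
  - exact: (measurable_integral_exp1 mgy (fun=> g0 _)).
  - by move=> x; apply: integral_ge0.
  apply: eq_integral => p _.
  rewrite (@integral_exp1_scale R s (fun y : R => g (p, y)))//; last exact: measurableT_comp mg (pair1 p).
  rewrite -ge0_integralZr//; last 3 first.
  - by apply: emeasurable_funM; [exact: measurableT_comp mg (pair1 p)|exact: measurable_pdf].
  - by move=> q _; rewrite mule_ge0 ?pdf_ge0.
  - exact: pdf_ge0.
  apply: eq_integral => q _; rewrite /h -muleA -EFinM/=.
  by rewrite [(exponential_pdf s q * _)%R]mulrC.
have split (p : R) : \int[mu]_q h (p, q) =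
    \int[mu]_q (h (p, q) * le1 (p, q)) + \int[mu]_q (h (p, q) * lt2 (p, q)).
  rewrite -ge0_integralD//; last 2 first.
  - exact: (measurableT_comp mhle (pair1 p)).
  - exact: (measurableT_comp mhlt (pair1 p)).
  apply: eq_integral => q _; rewrite /le1 /lt2/= ltNge.
  by case: (q <= p)%R; rewrite mule1 mule0 ?adde0 ?add0e.
pose le2 (z : R * R) : \bar R := ((z.1 <= z.2)%R%:R)%:E.
have mle2 : measurable_fun setT le2.
  by apply: measurable_boolE; exact: measurable_fun_ler.
have mhle2 : measurable_fun setT (fun z => h z * le2 z) by exact: emeasurable_funM.
pose A (p : R) := \int[mu]_q (h (p, q) * le1 (p, q)).
pose B (p : R) := \int[mu]_q (h (p, q) * lt2 (p, q)).
have mA : measurable_fun setT A.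
  exact: (@measurable_fun_fubini_tonelli_F _ _ _ _ R mu _ mhle hle0).
have mB : measurable_fun setT B.
  exact: (@measurable_fun_fubini_tonelli_F _ _ _ _ R mu _ mhlt hlt0).
have A0 p : 0 <= A p by apply: integral_ge0 => q _; exact: hle0.
have B0 p : 0 <= B p by apply: integral_ge0 => q _; exact: hlt0.
transitivity (\int[mu]_p (A p + B p)).
  by apply: eq_integral => p _; exact: split.
etransitivity.
  exact: (@ge0_integralD _ (measurableTypeR R) R mu setT measurableT A B
    (fun p _ => A0 p) mA (fun p _ => B0 p) mB).
apply: f_equal2; first exact: (@fubini_tonelli _ _ _ _ R mu mu _ mhle hle0).
apply: eq_integral => p _; apply: ge0_ae_eq_integral; first exact: measurableT.
- exact: (measurableT_comp mhlt (pair1 p)).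
- apply: (eq_measurable_fun (fun q : R => h (p, q) * le2 (p, q))).
    by move=> q _; rewrite /h /le2 mulrC.
  exact: (measurableT_comp mhle2 (pair1 p)).
- by move=> q _; exact: hlt0.
- move=> q _; apply: mule_ge0; last by rewrite lee_fin ler0n.
  by rewrite mulrC; exact: (h0 (p, q)).
(* The two indicators only differ on a tie of the clocks. *)
exists [set p]; split; [exact: measurable_set1|exact: lebesgue_measure_set1|].
move=> q; apply: contra_notP => /eqP qp _; rewrite /h /lt2 /= lt_neqAle.
by rewrite [p == q]eq_sym qp [(exponential_pdf s q * _)%R]mulrC.
Qed.

End race.

Section cell_integral.
Variable R : realType.
Local Notation exp1 := (exp1 R).
Local Open Scope ereal_scope.

Lemma eq_integral_exp1 (f g : R -> \bar R) :
  measurable_fun setT f -> measurable_fun setT g ->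
  (forall x, 0 <= f x) -> (forall x, 0 <= g x) ->
  (forall x, (0 <= x)%R -> f x = g x) ->
  \int[exp1]_x f x = \int[exp1]_x g x.
Proof.
move=> mf mg f0 g0 fg; apply: ge0_ae_eq_integral => //.
exists [set x | (x < 0)%R]; split; last 2 first.
- exact: exp1_lt0.
- by move=> x /=; apply: contra_notP => /negP; rewrite -leNgt => x0 _; exact: fg.
have -> : [set x : R | (x < 0)%R] = `]-oo, 0%R[%classic.
  by apply/seteqP; split=> x; rewrite /= in_itv.
exact: measurable_itv.
Qed.

Lemma exp1_swap (f : R * R -> \bar R) :
  measurable_fun setT f -> (forall z, 0 <= f z) ->
  \int[exp1]_x \int[exp1]_y f (x, y) = \int[exp1]_y \int[exp1]_x f (x, y).
Proof. by move=> mf f0; exact: (@fubini_tonelli _ _ _ _ R exp1 exp1 _ mf f0). Qed.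

Lemma measurable_exp1_int (d : measure_display) (T : measurableType d)
    (f : T -> R -> \bar R) :
  measurable_fun setT (fun z : T * R => f z.1 z.2) -> (forall x y, 0 <= f x y) ->
  measurable_fun setT (fun x => \int[exp1]_y f x y).
Proof.
move=> mf f0.
exact: (measurable_integral_exp1 (f := fun z => f z.1 z.2) mf (fun z => f0 _ _)).
Qed.

Variables (r s : R) (r0 : (0 < r)%R) (s0 : (0 < s)%R) (rs : (r + s = 1)%R).
Variable K : R -> R -> R -> \bar R.
Hypothesis mK : measurable_fun setT (fun z : R * R * R => K z.1.1 z.1.2 z.2).
Hypothesis K0 : forall x y z, 0 <= K x y z.

Let mK3 d (T : measurableType d) (f g h : T -> R) :
  measurable_fun setT f -> measurable_fun setT g -> measurable_fun setT h ->
  measurable_fun setT (fun t => K (f t) (g t) (h t)).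
Proof.
move=> mf mg mh.
apply: (measurableT_comp mK (g := fun t => (f t, g t, h t))).
by apply: measurable_fun_pair => //; exact: measurable_fun_pair.
Qed.

(** Burke's property of one cell.  By [exp1_race] the minimum of the two increments is
    independent of the identity of the larger one and of its excess, and has the law of the
    fresh weight o; hence exchanging the minimum with o preserves the joint law. *)
Lemma exp1_cell :
  \int[exp1]_o \int[exp1]_x \int[exp1]_y
    K (o + x / r - Num.min (x / r) (y / s))%R (o + y / s - Num.min (x / r) (y / s))%R
      (Num.min (x / r) (y / s))%R =
  \int[exp1]_x \int[exp1]_y \int[exp1]_o K (x / r)%R (y / s)%R o.
Proof.
have mfst1 : measurable_fun setT (fun z : R * R * R => z.1.1) by exact: measurableT_comp.
have msnd1 : measurable_fun setT (fun z : R * R * R => z.1.2) by exact: measurableT_comp.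
pose A q x o := K (q + x / r)%R q o.
pose B p y o := K p (p + y / s)%R o.
have mA3 d (T : measurableType d) (f g h : T -> R) : measurable_fun setT f ->
    measurable_fun setT g -> measurable_fun setT h ->
    measurable_fun setT (fun t => A (f t) (g t) (h t)).
  move=> mf mg mh; apply: mK3 => //; apply: measurable_funD => //.
  exact: measurable_funM.
have mB3 d (T : measurableType d) (f g h : T -> R) : measurable_fun setT f ->
    measurable_fun setT g -> measurable_fun setT h ->
    measurable_fun setT (fun t => B (f t) (g t) (h t)).
  move=> mf mg mh; apply: mK3 => //; apply: measurable_funD => //.
  exact: measurable_funM.
have A0 q x o : 0 <= A q x o by exact: K0.
have B0 q x o : 0 <= B q x o by exact: K0.
transitivity (s%:E * \int[exp1]_q \int[exp1]_x \int[exp1]_o A q x o +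
  r%:E * \int[exp1]_p \int[exp1]_y \int[exp1]_o B p y o); last first.
  symmetry.
  apply: (@exp1_race R r s (fun z => \int[exp1]_o K z.1 z.2 o) r0 s0 rs).
  - by apply: measurable_exp1_int => // *; apply: K0.
  - by move=> z; apply: integral_ge0.
have race o : \int[exp1]_x \int[exp1]_y
    K (o + x / r - Num.min (x / r) (y / s))%R (o + y / s - Num.min (x / r) (y / s))%R
      (Num.min (x / r) (y / s))%R =
    s%:E * \int[exp1]_q \int[exp1]_x A o x q +
    r%:E * \int[exp1]_p \int[exp1]_y B o y p.
  pose g (z : R * R) := K (o + z.1 - Num.min z.1 z.2)%R (o + z.2 - Num.min z.1 z.2)%R
      (Num.min z.1 z.2).
  have mmin : measurable_fun setT (fun z : R * R => Num.min z.1 z.2).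
    exact: measurable_minr.
  have mg : measurable_fun setT g.
    apply: mK3 => //; apply: measurable_funB => //; exact: measurable_funD.
  have g0 z : 0 <= g z by exact: K0.
  rewrite (@exp1_race R r s g r0 s0 rs mg g0).
  have pm (c q : R) : measurable_fun setT (fun x : R => (q + x / c)%R).
    by apply: measurable_funD => //; exact: measurable_funM.
  apply: f_equal2; apply: (f_equal (mule _)); apply: eq_integral => q _;
    apply: eq_integral_exp1.
  - by apply: measurableT_comp => //; exact: measurable_fun_pair.
  - exact: mA3.
  - by [].
  - by move=> x; exact: A0.
  - move=> x x0; rewrite /g /A /=.
    have xr : (0 <= x / r)%R by rewrite divr_ge0// ltW.
    by rewrite min_r ?lerDl//; apply: (f_equal2 (fun a b => K a b q)); ring.
  - by apply: measurableT_comp => //; exact: measurable_fun_pair.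
  - exact: mB3.
  - by [].
  - by move=> x; exact: B0.
  - move=> x x0; rewrite /g /B /=.
    have xr : (0 <= x / s)%R by rewrite divr_ge0// ltW.
    by rewrite min_l ?lerDl//; apply: (f_equal2 (fun a b => K a b q)); ring.
transitivity (\int[exp1]_o (s%:E * \int[exp1]_q \int[exp1]_x A o x q +
    r%:E * \int[exp1]_p \int[exp1]_y B o y p)).
  by apply: eq_integral => o _; exact: race.
have mA2 : measurable_fun setT (fun o : R => \int[exp1]_q \int[exp1]_x A o x q).
  apply: measurable_exp1_int; last by move=> *; exact: integral_ge0.
  by apply: measurable_exp1_int => //; exact: mA3.
have mB2 : measurable_fun setT (fun o : R => \int[exp1]_q \int[exp1]_x B o x q).
  apply: measurable_exp1_int; last by move=> *; exact: integral_ge0.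
  by apply: measurable_exp1_int => //; exact: mB3.
have IA0 (o : R) : 0 <= \int[exp1]_q \int[exp1]_x A o x q.
  by apply: integral_ge0 => *; exact: integral_ge0.
have IB0 (o : R) : 0 <= \int[exp1]_q \int[exp1]_x B o x q.
  by apply: integral_ge0 => *; exact: integral_ge0.
etransitivity.
  apply: (@ge0_integralD _ (measurableTypeR R) R exp1 setT measurableT
    (fun o => s%:E * \int[exp1]_q \int[exp1]_x A o x q)
    (fun o => r%:E * \int[exp1]_q \int[exp1]_x B o x q)).
  - by move=> o _; rewrite mule_ge0// lee_fin ltW.
  - exact: measurable_funeM.
  - by move=> o _; rewrite mule_ge0// lee_fin ltW.
  - exact: measurable_funeM.
have s1 : 0 <= s%:E by rewrite lee_fin ltW.
have r1 : 0 <= r%:E by rewrite lee_fin ltW.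
apply: f_equal2.
  etransitivity.
    exact: (@ge0_integralZl _ (measurableTypeR R) R exp1 setT measurableT _ mA2
      s%:E (fun o _ => IA0 o) s1).
  apply: (f_equal (mule _)); apply: eq_integral => o _; symmetry.
  by apply: (@exp1_swap (fun z => A o z.1 z.2)) => //; exact: mA3.
etransitivity.
  exact: (@ge0_integralZl _ (measurableTypeR R) R exp1 setT measurableT _ mB2
    r%:E (fun o _ => IB0 o) r1).
apply: (f_equal (mule _)); apply: eq_integral => o _; symmetry.
by apply: (@exp1_swap (fun z => B o z.1 z.2)) => //; exact: mB3.
Qed.

End cell_integral.

(** * Random environments with independent exponential coordinates *)

Section environment.
Variable R : realType.

Definition upd (v : nat * nat -> R) z (x : R) : nat * nat -> R :=
  fun z' => if z' == z then x else v z'.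

(** A generating family of cylinders stable under intersections. *)
Definition boxes : set (set (nat * nat -> R)) :=
  [set B | exists (J : {fset nat * nat}) (A : nat * nat -> set R),
    (forall i, measurable (A i)) /\ B = [set v | forall i, i \in J -> A i (v i)]].

Definition env := g_sigma_algebraType boxes.

Lemma boxes_setI : setI_closed boxes.
Proof.
move=> _ _ [J [A [mA ->]]] [J' [A' [mA' ->]]].
exists (J `|` J')%fset.
exists (fun i => (if i \in J then A i else setT) `&` (if i \in J' then A' i else setT)).
split.
  by move=> i; apply: measurableI; case: ifP.
apply/seteqP; split=> v /=.
  move=> [vA vA'] i _; split; case: ifP => // iJ; [exact: vA|exact: vA'].
move=> vAA; split=> i iJ; have := vAA i; rewrite in_fsetU iJ ?orbT => /(_ isT)[].
  by [].
by [].
Qed.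

Lemma boxes_setT : boxes setT.
Proof.
by exists fset0, (fun=> setT); split=> //; apply/seteqP; split.
Qed.

Lemma measurable_coord z : measurable_fun setT (fun v : env => v z).
Proof.
move=> _ A mA; rewrite setTI; apply: sub_sigma_algebra.
exists [fset z]%fset, (fun=> A); split=> //.
by apply/seteqP; split=> v /= vA; [move=> i /fset1P ->|apply: vA; rewrite inE].
Qed.

Lemma measurable_env d (T : measurableType d) (X : T -> env) :
  (forall z, measurable_fun setT (fun t => X t z)) -> measurable_fun setT X.
Proof.
move=> mX; apply: (@measurability _ _ T env setT X boxes) => // _ [_ [J [A [mA ->]] <-]].
rewrite setTI (_ : _ @^-1` _ = \bigcap_(i in [set` J]) ((X^~ i) @^-1` A i)).
  apply: fin_bigcap_measurable => [|i _]; first exact: finite_fset.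
  by rewrite -[X in measurable X]setTI; exact: mX.
by [].
Qed.

Lemma measurable_upd z : measurable_fun setT (fun p : env * R => upd p.1 z p.2 : env).
Proof.
apply: measurable_env => z'; rewrite /upd; case: (z' == z); first exact: measurable_snd.
exact: (measurableT_comp (measurable_coord z') measurable_fst).
Qed.

Section resampling.
Variables (d : measure_display) (T : measurableType d) (P : probability T R).
Variable X : T -> env.
Hypothesis mX : forall z, measurable_fun setT (fun t => X t z).
Hypothesis boxX : forall (J : {fset nat * nat}) (A : nat * nat -> set R),
  (forall i, measurable (A i)) ->
  P [set t | forall i, i \in J -> A i (X t i)] = (\prod_(i <- J) exp1 R (A i))%E.

Local Open Scope ereal_scope.

Let measurable_box (J : {fset nat * nat}) (A : nat * nat -> set R) :
  (forall i, measurable (A i)) ->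
  measurable [set t | forall i, i \in J -> A i (X t i)].
Proof.
move=> mA; rewrite (_ : [set t | _] = \bigcap_(i in [set` J]) ((X^~ i) @^-1` A i))//.
apply: fin_bigcap_measurable => [|i _]; first exact: finite_fset.
by rewrite -[X in measurable X]setTI; exact: mX.
Qed.

(** Replacing one coordinate by a fresh independent copy does not change the law, because the
    two laws agree on boxes. *)
Lemma exp1_resampling z (F : env -> \bar R) :
  measurable_fun setT F -> (forall v, 0 <= F v) ->
  \int[P]_t F (X t) = \int[P]_t \int[exp1 R]_x F (upd (X t) z x).
Proof.
move=> mF F0.
have mXe : measurable_fun setT X by exact: measurable_env.
pose Y (p : T * measurableTypeR R) : env := upd (X p.1) z p.2.
have mY : measurable_fun setT Y.
  apply: (measurableT_comp (measurable_upd z) (g := fun p => (X p.1, p.2))).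
  by apply: measurable_fun_pair => //; exact: measurableT_comp mXe _.
pose m1 := image_measure P mXe.
pose m2 := image_measure (P \x exp1 R)%E mY.
have m12 : forall A : set env, measurable A -> m1 A = m2 A.
  have cover : \bigcup_(_ in @setT nat) (@setT env) = setT by rewrite bigcup_const.
  apply: (@measure_unique _ R env boxes (fun=> setT) erefl boxes_setI
    (fun=> boxes_setT) cover m1 m2).
  - move=> _ [J [A [mA ->]]].
    rewrite /m1 /m2 /image_measure/= /pushforward/=.
    etransitivity; first exact: boxX.
    pose C := if z \in J then A z else setT.
    have mC : measurable C by rewrite /C; case: ifP.
    rewrite (_ : Y @^-1` _ =
      [set t | forall i, i \in (J `\ z)%fset -> A i (X t i)] `*` C); last first.
      apply/seteqP; split=> [[t x]|[t x]] /=; rewrite /Y /C /upd /=.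
        move=> vA; split=> [i /fsetD1P[iz iJ]|].
          by have := vA i iJ; rewrite (negbTE iz).
        by case: ifP => // zJ; have := vA z zJ; rewrite eqxx.
      move=> [vA xC] i iJ; case: eqP => [iz|/eqP iz]; last by apply: vA; apply/fsetD1P.
      by move: xC; rewrite -iz iJ.
    rewrite product_measure1E//; last exact: measurable_box.
    transitivity (\prod_(i <- (J `\ z)%fset) exp1 R (A i) * exp1 R C); last first.
      by apply: (f_equal2 mule) => //; symmetry; exact: boxX.
    rewrite /C; case: ifPn => zJ.
      by rewrite (big_fsetD1 z)//= muleC.
    by rewrite probability_setT mule1 mem_fsetD1.
  - by move=> _; rewrite /m1/= /pushforward preimage_setT probability_setT ltry.
transitivity (\int[m1]_v F v).
  rewrite /m1 /image_measure.
  by rewrite (@ge0_integral_pushforward _ _ _ _ R X mXe P setT F)// preimage_setT.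
transitivity (\int[m2]_v F v).
  by apply: eq_measure_integral => A mA _; exact: m12.
rewrite /m2 /image_measure.
rewrite (@ge0_integral_pushforward _ _ _ _ R Y mY _ setT F)// preimage_setT.
rewrite (@fubini_tonelli1 _ _ T (measurableTypeR R) R P (exp1 R) (F \o Y))//.
  exact: measurableT_comp.
by move=> p; exact: F0.
Qed.

End resampling.
End environment.

(** * Stationarity and tilting *)

Section measurability.
Variable R : realType.
Local Notation env := (env R).

Definition dil (d : nat * nat -> R) (v : nat * nat -> R) : nat * nat -> R :=
  fun z => d z * v z.

Lemma measurable_dil d : measurable_fun setT (dil d : env -> env).
Proof.
apply: measurable_env => z; apply: measurable_funM => //.
exact: measurable_coord.
Qed.

Lemma measurable_cell c : measurable_fun setT (cell c : env -> env).
Proof.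
have mc := @measurable_coord R.
apply: measurable_env => z; rewrite /cell.
case: (z == _).
  apply: measurable_funB; last exact: measurable_minr.
  exact: measurable_funD.
case: (z == _).
  apply: measurable_funB; last exact: measurable_minr.
  exact: measurable_funD.
by case: (z == c); [exact: measurable_minr|exact: mc].
Qed.

Lemma measurable_sweep cs : measurable_fun setT (sweep cs : env -> env).
Proof.
elim/last_ind: cs => [|cs c IH]; first exact: measurable_id.
rewrite (_ : sweep _ = cell c \o sweep cs); last first.
  by apply/funext => v; rewrite sweep_rcons.
exact: (measurableT_comp (measurable_cell c) IH).
Qed.

Lemma measurable_lpp i j : measurable_fun setT (fun v : env => lpp v i j).
Proof.
have mc := @measurable_coord R.
elim: i j => [|i IHi]; elim=> [|j IHj].
- exact: mc.
- exact: measurable_funD (mc _) IHj.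
- exact: measurable_funD (mc _) (IHi 0%N).
- exact: measurable_funD (mc _) (measurable_maxr (IHi j.+1) IHj).
Qed.

Lemma measurable_exits_hor i j :
  measurable_fun setT (fun v : env => exits_hor (steps_left v) i j).
Proof.
elim: i j => [|i IHi]; elim=> [|j IHj].
- exact: measurable_cst.
- exact: measurable_cst.
- exact: measurable_cst.
- have mlt : measurable_fun setT (fun v : env => steps_left v i.+1 j.+1).
    exact: measurable_fun_ltr (measurable_lpp _ _) (measurable_lpp _ _).
  exact: measurable_fun_ifT mlt (IHi j.+1) IHj.
Qed.

Lemma measurable_sum_env (s : seq (nat * nat)) :
  measurable_fun setT (fun v : env => \sum_(z <- s) v z).
Proof.
elim: s => [|z s IH].
  by rewrite (_ : (fun v : env => _) = cst 0) //; apply/funext => v; rewrite big_nil.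
rewrite (_ : (fun v : env => _) = (fun v => v z + \sum_(z <- s) v z)).
  exact: measurable_funD (@measurable_coord R z) IH.
by apply/funext => v; rewrite big_cons.
Qed.

Lemma measurable_expRE d (T : measurableType d) (f : T -> R) :
  measurable_fun setT f -> measurable_fun setT (fun t => (expR (f t))%:E).
Proof. by move=> mf; apply/measurable_EFinP; exact: measurableT_comp. Qed.

End measurability.

Section stationary.
Variable R : realType.
Local Notation env := (env R).
Local Notation exp1 := (exp1 R).
Variables (d : measure_display) (T : measurableType d) (P : probability T R).
Variable X : T -> env.
Hypothesis mX : measurable_fun setT X.
Local Open Scope ereal_scope.
Hypothesis resample : forall z (F : env -> \bar R),
  measurable_fun setT F -> (forall v, 0 <= F v) ->
  \int[P]_t F (X t) = \int[P]_t \int[exp1]_x F (upd (X t) z x).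

Local Notation Ex F := (\int[P]_t F (X t)).

Lemma measurable_exp1_upd z (F : env -> \bar R) : measurable_fun setT F ->
  (forall v, 0 <= F v) ->
  measurable_fun setT (fun v : env => \int[exp1]_x F (upd v z x)).
Proof.
move=> mF F0; apply: measurable_exp1_int => // .
exact: (measurableT_comp mF (@measurable_upd R z)).
Qed.

Lemma resample2 z1 z2 (F : env -> \bar R) :
  measurable_fun setT F -> (forall v, 0 <= F v) ->
  Ex F = \int[P]_t \int[exp1]_x1 \int[exp1]_x2 F (upd (upd (X t) z1 x1) z2 x2).
Proof.
move=> mF F0; rewrite (resample z2 mF F0).
apply: (resample z1 (measurable_exp1_upd z2 mF F0)).
by move=> v; apply: integral_ge0.
Qed.

Lemma resample3 z1 z2 z3 (F : env -> \bar R) :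
  measurable_fun setT F -> (forall v, 0 <= F v) ->
  Ex F = \int[P]_t \int[exp1]_x1 \int[exp1]_x2 \int[exp1]_x3
    F (upd (upd (upd (X t) z1 x1) z2 x2) z3 x3).
Proof.
move=> mF F0; rewrite (resample z3 mF F0).
apply: (resample2 z1 z2 (measurable_exp1_upd z3 mF F0)).
by move=> v; apply: integral_ge0.
Qed.

Lemma tilt1 z (c : R) (F : env -> \bar R) : (c < 1)%R ->
  measurable_fun setT F -> (forall v, 0 <= F v) ->
  Ex (fun v => F v * (expR (c * v z))%:E) =
  (1 - c)^-1%:E * Ex (fun v => F (upd v z (v z / (1 - c))%R)).
Proof.
move=> c1 mF F0.
have mu2 : measurable_fun setT (fun v : env => upd v z (v z / (1 - c))%R : env).
  apply: (measurableT_comp (@measurable_upd R z) (g := fun v : env => (v, (v z / (1 - c))%R))).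
  apply: measurable_fun_pair => //; apply: measurable_funM => //.
  exact: measurable_coord.
have mF2 : measurable_fun setT (fun v : env => F (upd v z (v z / (1 - c))%R)).
  exact: (measurableT_comp mF mu2).
have mF3 : measurable_fun setT (fun v : env => F v * (expR (c * v z))%:E).
  apply: emeasurable_funM => //; apply: measurable_expRE.
  by apply: measurable_funM => //; exact: measurable_coord.
have F30 v : 0 <= F v * (expR (c * v z))%:E by rewrite mule_ge0// lee_fin expR_ge0.
rewrite (resample z mF3 F30) (resample z mF2 (fun=> F0 _)).
have mupd1 v : measurable_fun setT (fun x : R => upd v z x : env).
  by apply: measurable_env => z'; rewrite /upd; case: (z' == z).
have mI := measurable_exp1_upd z mF2 (fun=> F0 _).
rewrite -(@ge0_integralZl _ T R P setT measurableT
  (fun t => \int[exp1]_x F (upd (upd (X t) z x) z (upd (X t) z x z / (1 - c))%R))).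
- apply: eq_integral => t _.
  have h := @integral_exp1_tilt R c (fun x => F (upd (X t) z x)) c1
    (measurableT_comp mF (mupd1 (X t))) (fun=> F0 _).
  etransitivity; last (etransitivity; first exact: h).
    by apply: eq_integral => x _; rewrite /upd eqxx.
  apply: (f_equal (mule _)); apply: eq_integral => x _; congr F.
  by apply/funext => z'; rewrite /upd eqxx; case: (z' == z).
- exact: (measurableT_comp mI mX).
- by move=> t _; exact: integral_ge0.
- by rewrite lee_fin invr_ge0 subr_ge0 ltW.
Qed.

Definition dil_on (s : seq (nat * nat)) (c : R) : nat * nat -> R :=
  fun z => if z \in s then c else 1%R.

Lemma tilt (s : seq (nat * nat)) (c : R) (F : env -> \bar R) : uniq s -> (c < 1)%R ->
  measurable_fun setT F -> (forall v, 0 <= F v) ->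
  Ex (fun v => F v * (expR (c * \sum_(z <- s) v z))%:E) =
  ((1 - c)^-1 ^+ size s)%:E * Ex (fun v => F (dil (dil_on s (1 - c)^-1) v)).
Proof.
move=> us c1; elim: s us F => [_|z s IH /andP[zs us]] F mF F0.
  rewrite expr0 mul1e; apply: eq_integral => t _.
  rewrite big_nil mulr0 expR0 mule1; congr F.
  by apply/funext => z; rewrite /dil /dil_on in_nil mul1r.
have mE : measurable_fun setT (fun v : env => (expR (c * \sum_(z <- s) v z))%:E).
  apply: measurable_expRE; apply: measurable_funM => //.
  exact: measurable_sum_env.
pose F2 (v : env) := F v * (expR (c * \sum_(z <- s) v z))%:E.
have mF2 : measurable_fun setT F2 by exact: emeasurable_funM.
have F20 v : 0 <= F2 v by rewrite mule_ge0// lee_fin expR_ge0.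
transitivity (Ex (fun v => F2 v * (expR (c * v z))%:E)).
  apply: eq_integral => t _; rewrite /F2 -muleA -EFinM -expRD -mulrDr big_cons.
  by rewrite [(X t z + _)%R]addrC.
rewrite (tilt1 z c1 mF2 F20).
have mu2 : measurable_fun setT (fun v : env => upd v z (v z / (1 - c))%R : env).
  apply: (measurableT_comp (@measurable_upd R z) (g := fun v : env => (v, (v z / (1 - c))%R))).
  apply: measurable_fun_pair => //; apply: measurable_funM => //.
  exact: measurable_coord.
have := IH us (fun v => F (upd v z (v z / (1 - c))%R)) (measurableT_comp mF mu2) (fun=> F0 _).
move=> h; etransitivity; first (apply: (f_equal (mule _)); etransitivity; last exact: h).
  apply: eq_integral => t _; rewrite /F2; congr (_ * (expR (c * _))%:E).
  apply: eq_big_seq => z' z's; rewrite /upd ifF//.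
  by apply/negbTE; apply: contraNneq zs => <-.
rewrite muleA -EFinM exprS; congr (_ * _); apply: eq_integral => t _; congr F.
apply/funext => z'; rewrite /upd /dil /dil_on inE.
have [->|_] := eqVneq z' z; last by [].
by rewrite (negbTE zs) mul1r mulrC.
Qed.

Lemma cell_upd c (u : env) (o p q : R) : inner c ->
  cell c (upd (upd (upd u c o) (c.1, 0)%N p) (0, c.2)%N q) =
  upd (upd (upd u (c.1, 0)%N (o + p - Num.min p q)%R)
    (0, c.2)%N (o + q - Num.min p q)%R) c (Num.min p q).
Proof.
case: c => i j /andP[/= i0 j0].
pose a := (i, 0)%N; pose b := (0, j)%N; pose c := (i, j).
have nab : (a == b) = false by rewrite xpair_eqE; lia.
have nca : (c == a) = false by rewrite xpair_eqE; lia.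
have ncb : (c == b) = false by rewrite xpair_eqE; lia.
apply/funext => z; rewrite /cell /upd /= -/a -/b -/c !eqxx nab nca ncb.
have [->|za] := eqVneq z a; first by rewrite eq_sym nca nab.
have [->|zb] := eqVneq z b; first by rewrite eq_sym ncb.
by case: (z == c).
Qed.

(** Only the three coordinates touched by the cell matter.  Resampling them in two different
    orders brings both sides to the form of [exp1_cell]. *)
Lemma stationary_cell c (r s : R) (D : nat * nat -> R) (F : env -> \bar R) :
  inner c -> (0 < r)%R -> (0 < s)%R -> (r + s = 1)%R ->
  D (c.1, 0)%N = r^-1%R -> D (0, c.2)%N = s^-1%R -> D c = 1%R ->
  measurable_fun setT F -> (forall v, 0 <= F v) ->
  Ex (fun v => F (cell c (dil D v))) = Ex (fun v => F (dil D v)).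
Proof.
move=> ic r0 s0 rs Dh Dv Dc mF F0.
pose a := (c.1, 0)%N; pose b := (0, c.2)%N.
have mD := @measurable_dil R D.
have mFD : measurable_fun setT (fun v : env => F (dil D v)).
  exact: (measurableT_comp mF mD).
have mFc : measurable_fun setT (fun v : env => F (cell c (dil D v))).
  exact: (measurableT_comp mF (measurableT_comp (@measurable_cell R c) mD)).
rewrite (resample3 c a b mFc (fun=> F0 _)) (resample3 a b c mFD (fun=> F0 _)).
apply: eq_integral => t _.
have dupd (v : env) z x : dil D (upd v z x) = upd (dil D v) z (D z * x)%R.
  by apply/funext => z'; rewrite /dil /upd; case: eqP => [->|].
have E1 o x y : dil D (upd (upd (upd (X t) c o) a x) b y) =
    upd (upd (upd (dil D (X t)) c o) a (x / r)%R) b (y / s)%R.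
  by rewrite !dupd Dh Dv Dc mul1r (mulrC _ x) (mulrC _ y).
have E2 o x y : dil D (upd (upd (upd (X t) a x) b y) c o) =
    upd (upd (upd (dil D (X t)) a (x / r)%R) b (y / s)%R) c o.
  by rewrite !dupd Dh Dv Dc mul1r (mulrC _ x) (mulrC _ y).
move: (dil D (X t)) E1 E2 => u E1 E2.
pose K p q o := F (upd (upd (upd u a p) b q) c o).
have mK : measurable_fun setT (fun z : R * R * R => K z.1.1 z.1.2 z.2).
  apply: (measurableT_comp mF); apply: measurable_env => z; rewrite /upd.
  case: (z == c); first exact: measurable_snd.
  case: (z == b); first exact: measurableT_comp.
  case: (z == a); first exact: measurableT_comp.
  exact: measurable_cst.
have K0 p q o : 0 <= K p q o by exact: F0.
have E3 o x y : F (cell c (dil D (upd (upd (upd (X t) c o) a x) b y))) =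
    K (o + x / r - Num.min (x / r) (y / s))%R (o + y / s - Num.min (x / r) (y / s))%R
      (Num.min (x / r) (y / s))%R.
  by rewrite E1 cell_upd.
have E4 o x y : F (dil D (upd (upd (upd (X t) a x) b y) c o)) = K (x / r)%R (y / s)%R o.
  by rewrite E2.
etransitivity; last (etransitivity; first exact: (exp1_cell r0 s0 rs mK K0)).
  apply: eq_integral => o _; apply: eq_integral => x _; apply: eq_integral => y _.
  exact: E3.
apply: eq_integral => x _; apply: eq_integral => y _; apply: eq_integral => o _.
by symmetry; exact: E4.
Qed.

Lemma stationary_sweep cs (r s : R) (D : nat * nat -> R) (F : env -> \bar R) :
  (0 < r)%R -> (0 < s)%R -> (r + s = 1)%R ->
  (forall c, c \in cs -> [/\ inner c, D (c.1, 0)%N = r^-1%R, D (0, c.2)%N = s^-1%R & D c = 1%R]) ->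
  measurable_fun setT F -> (forall v, 0 <= F v) ->
  Ex (fun v => F (sweep cs (dil D v))) = Ex (fun v => F (dil D v)).
Proof.
move=> r0 s0 rs; elim: cs => [//|c cs IH] Dcs mF F0.
have [ic Dh Dv Dc] := Dcs c (mem_head _ _).
have mFs : measurable_fun setT (fun v : env => F (sweep cs v)).
  exact: (measurableT_comp mF (@measurable_sweep R cs)).
have h := @stationary_cell c r s D _ ic r0 s0 rs Dh Dv Dc mFs (fun=> F0 _).
etransitivity; first exact: h.
by apply: IH => // c' c'cs; apply: Dcs; rewrite inE c'cs orbT.
Qed.

End stationary.

(** * Exit bound *)

Section boundary_model.
Variable R : realType.

(** Dilation factors turning rate 1 environments into environments with rates 1 / p and 1 / q
    on the first M and N points of the two axes. *)
Definition model M N (p q : R) : nat * nat -> R := fun z =>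
  if z \in haxis M then p else if z \in vaxis N then q else
  if (z.1 == 0)%N || (z.2 == 0)%N then 0 else 1.

Lemma mem_haxis M i j : ((i, j) \in haxis M) = (0 < i <= M)%N && (j == 0)%N.
Proof.
apply/mapP/idP => [[k]|/andP[iM /eqP ->]]; last by exists i => //; rewrite mem_iota; lia.
by rewrite mem_iota => kM [-> ->]; rewrite eqxx andbT; lia.
Qed.

Lemma mem_vaxis N i j : ((i, j) \in vaxis N) = (i == 0)%N && (0 < j <= N)%N.
Proof.
apply/mapP/idP => [[k]|/andP[/eqP -> jN]]; last by exists j => //; rewrite mem_iota; lia.
by rewrite mem_iota => kM [-> ->]; rewrite eqxx; lia.
Qed.

Lemma uniq_haxis M : uniq (haxis M).
Proof. by rewrite map_inj_uniq ?iota_uniq // => i j []. Qed.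

Lemma uniq_vaxis M : uniq (vaxis M).
Proof. by rewrite map_inj_uniq ?iota_uniq // => i j []. Qed.

Lemma size_haxis M : size (haxis M) = M.
Proof. by rewrite size_map size_iota. Qed.

Lemma size_vaxis M : size (vaxis M) = M.
Proof. by rewrite size_map size_iota. Qed.

Variables (M N : nat).

Lemma model_haxis p q z : z \in haxis M -> model M N p q z = p.
Proof. by rewrite /model => ->. Qed.

Lemma model_vaxis p q z : z \in vaxis N -> model M N p q z = q.
Proof.
case: z => i j zN; rewrite /model zN ifF //; apply/negbTE.
by move: zN; rewrite mem_vaxis mem_haxis; lia.
Qed.

Lemma model_inner p q z : inner z -> model M N p q z = 1.
Proof.
case: z => i j /andP[/= i0 j0]; rewrite /model mem_haxis mem_vaxis /=.
by rewrite !ifF //; lia.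
Qed.

Lemma model00 p q : model M N p q (0, 0)%N = 0.
Proof. by rewrite /model mem_haxis mem_vaxis. Qed.

Lemma model_hor p q i : model M N p q (i, 0)%N = if (0 < i <= M)%N then p else 0.
Proof. by rewrite /model mem_haxis mem_vaxis /= ?andbT ?andbF ?orbT. Qed.

Lemma model_ver p q j : model M N p q (0, j)%N = if (0 < j <= N)%N then q else 0.
Proof. by rewrite /model mem_haxis mem_vaxis /= ?andbF. Qed.

Lemma dil_model_haxis p q c v :
  dil (model M N p q) (dil (dil_on (haxis M) c) v) = dil (model M N (p * c) q) v.
Proof.
apply/funext => z; rewrite /dil /dil_on mulrA; congr (_ * _).
by rewrite /model; case: (z \in haxis M) => //; rewrite mulr1.
Qed.

Lemma dil_model_vaxis p q c v :
  dil (model M N p q) (dil (dil_on (vaxis N) c) v) = dil (model M N p (q * c)) v.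
Proof.
apply/funext => z; rewrite /dil /dil_on mulrA; congr (_ * _).
have [zN|zN] := boolP (z \in vaxis N); first by rewrite !model_vaxis.
by rewrite mulr1 /model (negbTE zN).
Qed.

Lemma sum_haxis_dil p q v :
  \sum_(z <- haxis M) dil (model M N p q) v z = p * \sum_(z <- haxis M) v z.
Proof.
by rewrite big_distrr /=; apply: eq_big_seq => z zM; rewrite /dil model_haxis.
Qed.

Lemma sum_vaxis_dil p q v :
  \sum_(z <- vaxis N) dil (model M N p q) v z = q * \sum_(z <- vaxis N) v z.
Proof.
by rewrite big_distrr /=; apply: eq_big_seq => z zM; rewrite /dil model_vaxis.
Qed.

Lemma zero_axes_dil p q v : zero_axes (dil (model M N p q) v) = zero_axes v.
Proof.
apply/funext => z; rewrite /zero_axes; case: ifPn => //; rewrite negb_or => /andP[z1 z2].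
by rewrite /dil model_inner ?mul1r// /inner !lt0n z1 z2.
Qed.

End boundary_model.

Section exit_bound.
Variable R : realType.
Local Notation env := (env R).
Local Notation exp1 := (exp1 R).
Variables (d : measure_display) (T : measurableType d) (P : probability T R).
Variable X : T -> env.
Hypothesis mX : measurable_fun setT X.
Hypothesis X0 : forall t z, 0 <= X t z.
Local Open Scope ereal_scope.
Hypothesis resample : forall z (F : env -> \bar R),
  measurable_fun setT F -> (forall v, 0 <= F v) ->
  \int[P]_t F (X t) = \int[P]_t \int[exp1]_x F (upd (X t) z x).

Local Notation Ex F := (\int[P]_t F (X t)).
Variables M N : nat.
Local Notation stat w := (model M N w^-1%R (1 - w)^-1%R).

Lemma stationary_grid (w : R) (F : env -> \bar R) : (0 < w < 1)%R ->
  measurable_fun setT F -> (forall v, 0 <= F v) ->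
  Ex (fun v => F (sweep (grid M N) (dil (stat w) v))) = Ex (fun v => F (dil (stat w) v)).
Proof.
move=> /andP[w0 w1] mF F0.
apply: (stationary_sweep resample (r := w) (s := (1 - w)%R)) => //.
- by rewrite subr_gt0.
- by rewrite addrC subrK.
- move=> [i j] /allpairsP[[l k] /= [+ + [-> ->]]]; rewrite !mem_iota => lN kM.
  split; first by rewrite /inner /=; lia.
  + by rewrite model_hor; case: ifP => //; lia.
  + by rewrite model_ver; case: ifP => //; lia.
  + by rewrite model_inner // /inner /=; lia.
Qed.

Lemma le_Ex (F G : env -> \bar R) : measurable_fun setT F -> measurable_fun setT G ->
  (forall v, 0 <= F v) -> (forall v, (forall z, (0 <= v z)%R) -> F v <= G v) ->
  Ex F <= Ex G.
Proof.
move=> mF mG F0 FG; apply: ge0_le_integral => //.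
- exact: (measurableT_comp mF mX).
- exact: (measurableT_comp mG mX).
- by move=> t _; apply: FG.
Qed.

Lemma Ex1 : Ex (fun=> 1) = 1.
Proof. by rewrite integral_cst// mul1e; exact: probability_setT. Qed.

Definition exits_hor_ind (v : nat * nat -> R) : \bar R := ((exits_hor (steps_left v) M N)%:R)%:E.

Lemma measurable_exits_hor_ind : measurable_fun setT (exits_hor_ind : env -> \bar R).
Proof. exact: measurable_boolE (@measurable_exits_hor R M N). Qed.

Lemma exits_hor_ind_ge0 v : 0 <= exits_hor_ind v. Proof. by rewrite lee_fin ler0n. Qed.

(** In the coordinates after the sweep, which have the same law, the tilt acts on independent
    entries of the horizontal axis and amounts to dilating them; by [exits_hor_sweep] this
    keeps horizontal exits horizontal.  The factor in front is the total mass of the tilt. *)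
Lemma exits_hor_le_tilt (w a : R) : (0 < w < 1)%R -> (0 < a < w)%R ->
  ((w / (w - a)) ^+ M)%:E * Ex (fun v => exits_hor_ind (dil (stat w) v)) <=
  Ex (fun v => exits_hor_ind (dil (stat w) v) *
    (expR (a * \sum_(z <- haxis M) sweep (grid M N) (dil (stat w) v) z))%:E).
Proof.
move=> w01 /andP[a0 aw]; have /andP[w0 w1] := w01.
pose D := dil (stat w).
have mD : measurable_fun setT (D : env -> env) by exact: measurable_dil.
pose H (u : env) : \bar R := exits_hor_ind (sweep (rev (grid M N)) u).
have mH : measurable_fun setT H.
  exact: (measurableT_comp measurable_exits_hor_ind (@measurable_sweep R _)).
have HE v : exits_hor_ind (D v) = H (sweep (grid M N) (D v)).
  by rewrite /H sweepK // inner_grid.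
pose F (u : env) := H u * (expR (a * \sum_(z <- haxis M) u z))%:E.
have mexp (c : R) : measurable_fun setT (fun u : env => (expR (c * \sum_(z <- haxis M) u z))%:E).
  by apply: measurable_expRE; apply: measurable_funM => //; exact: measurable_sum_env.
have mF : measurable_fun setT F by exact: emeasurable_funM.
have F0 u : 0 <= F u by rewrite mule_ge0 ?exits_hor_ind_ge0// lee_fin expR_ge0.
have -> : Ex (fun v => exits_hor_ind (dil (stat w) v) *
    (expR (a * \sum_(z <- haxis M) sweep (grid M N) (dil (stat w) v) z))%:E) =
    Ex (fun v => F (sweep (grid M N) (D v))).
  by apply: eq_integral => t _; rewrite /F -HE.
rewrite (stationary_grid w01 mF F0).
have mHD : measurable_fun setT (fun v : env => H (D v)) by exact: (measurableT_comp mH mD).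
have aw1 : (a / w < 1)%R by rewrite ltr_pdivrMr// mul1r.
have -> : Ex (fun v => F (D v)) =
    Ex (fun v => H (D v) * (expR (a / w * \sum_(z <- haxis M) v z))%:E).
  by apply: eq_integral => t _; rewrite /F /D sum_haxis_dil mulrA.
rewrite (tilt mX resample (uniq_haxis M) aw1 mHD (fun=> exits_hor_ind_ge0 _)) size_haxis.
have c1 : ((1 - a / w)^-1 = w / (w - a))%R.
  have wn : w != 0%R by rewrite gt_eqF.
  have wan : (w - a)%R != 0%R by rewrite gt_eqF// subr_gt0.
  by field; rewrite wan wn.
rewrite c1; apply: lee_wpmul2l.
  by rewrite lee_fin exprn_ge0 // ltW // divr_gt0 // subr_gt0.
have -> : Ex (fun v => exits_hor_ind (dil (stat w) v)) = Ex (fun v => H (D v)).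
  rewrite -(stationary_grid w01 mH (fun=> exits_hor_ind_ge0 _)).
  by apply: eq_integral => t _; rewrite -HE.
have wa1 : (1 <= w / (w - a))%R by rewrite ler_pdivlMr ?subr_gt0// mul1r gerBl ltW.
apply: (le_Ex (F := fun v => H (D v))
  (G := fun v => H (D (dil (dil_on (haxis M) (w / (w - a))%R) v)))).
- exact: mHD.
- exact: (measurableT_comp mHD (@measurable_dil R _)).
- by move=> v; exact: exits_hor_ind_ge0.
move=> v v0; rewrite /D dil_model_haxis /H /exits_hor_ind lee_fin ler_nat.
set u := dil _ v; set u' := dil _ v.
suff : exits_hor (steps_left (sweep (rev (grid M N)) u)) M N ->
    exits_hor (steps_left (sweep (rev (grid M N)) u')) M N.
  by do 2 case: exits_hor => //; move=> /(_ isT).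
apply: exits_hor_sweep; rewrite !sweep_revK ?inner_grid //; split.
- move=> i i0; rewrite /u /u' /dil !model_hor; case: ifP => // _.
  by rewrite ler_wpM2r// ler_peMr// invr_ge0 ltW.
- by move=> j j0; rewrite /u /u' /dil !model_ver.
- move=> z zg; rewrite /u /u' /dil !model_inner //; exact: (allP (inner_grid M N)).
Qed.

(** Tilting the vertical axis by exp (- a _) raises its rate from 1 - w to 1 - w + a. *)
Lemma tilt_vaxis (w a : R) (G : env -> \bar R) : (0 < w < 1)%R -> (0 < a)%R ->
  measurable_fun setT G -> (forall v, 0 <= G v) ->
  Ex (fun v => G v * (expR (- a * \sum_(z <- vaxis N) dil (stat w) v z))%:E) =
  (((1 - w) / (1 - w + a)) ^+ N)%:E *
  Ex (fun v => G (dil (dil_on (vaxis N) ((1 - w) / (1 - w + a))%R) v)).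
Proof.
move=> /andP[w0 w1] a0 mG G0.
have w1' : (0 < 1 - w)%R by rewrite subr_gt0.
have c1 : ((1 - - a / (1 - w))^-1 = (1 - w) / (1 - w + a))%R.
  have wn : (1 - w)%R != 0%R by rewrite gt_eqF.
  have wan : (1 - w + a)%R != 0%R by rewrite gt_eqF// addr_gt0.
  by field; rewrite wan wn.
have cl1 : (- a / (1 - w) < 1)%R.
  by rewrite ltr_pdivrMr// mul1r (lt_trans _ w1')// oppr_lt0.
rewrite -c1 -[X in (_ ^+ X)%:E](size_vaxis N).
rewrite -(tilt mX resample (uniq_vaxis N) cl1 mG G0).
by apply: eq_integral => t _; rewrite sum_vaxis_dil mulrA.
Qed.

Lemma measurable_exp_lpp (a p q : R) :
  measurable_fun setT (fun v : env => (expR (a * lpp (dil (model M N p q) v) M N))%:E).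
Proof.
apply: measurable_expRE; apply: measurable_funM => //.
exact: (measurableT_comp (@measurable_lpp R M N) (@measurable_dil R _)).
Qed.

(** Tilting back to vertical rate 1 - w makes the model stationary and removes from the
    last-passage value the contribution of the vertical axis; what remains is the sum of the
    horizontal increments along the far side, a sum of independent exponentials. *)
Lemma exp_moment_lpp (w a : R) : (0 < w < 1)%R -> (0 < a < w)%R ->
  (((1 - w) / (1 - w + a)) ^+ N)%:E *
  Ex (fun v => (expR (a * lpp (dil (model M N w^-1 (1 - w + a)^-1)%R v) M N))%:E) =
  ((w / (w - a)) ^+ M)%:E.
Proof.
move=> w01 /andP[a0 aw]; have /andP[w0 w1] := w01.
have w1' : (0 < 1 - w)%R by rewrite subr_gt0.
pose G (v : env) := (expR (a * lpp (dil (stat w) v) M N))%:E.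
have mG : measurable_fun setT G by exact: measurable_exp_lpp.
have G0 v : 0 <= G v by rewrite lee_fin expR_ge0.
have := tilt_vaxis w01 a0 mG G0.
have -> : Ex (fun v => G (dil (dil_on (vaxis N) ((1 - w) / (1 - w + a))%R) v)) =
  Ex (fun v => (expR (a * lpp (dil (model M N w^-1 (1 - w + a)^-1)%R v) M N))%:E).
  apply: eq_integral => t _; rewrite /G dil_model_vaxis mulrA mulVf ?mul1r//.
  by rewrite gt_eqF.
move=> <-.
pose F (u : env) := (expR (a * \sum_(z <- haxis M) u z))%:E.
have mF : measurable_fun setT F.
  by apply: measurable_expRE; apply: measurable_funM => //; exact: measurable_sum_env.
have F0 u : 0 <= F u by rewrite lee_fin expR_ge0.
transitivity (Ex (fun v => F (sweep (grid M N) (dil (stat w) v)))).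
  apply: eq_integral => t _; rewrite /F /G -EFinM -expRD sum_haxis_sweep ?mulrBr ?mulNr//.
  by rewrite /dil model00 mul0r.
rewrite (stationary_grid w01 mF F0).
have aw1 : (a / w < 1)%R by rewrite ltr_pdivrMr// mul1r.
transitivity (Ex (fun v => 1 * (expR (a / w * \sum_(z <- haxis M) v z))%:E)).
  by apply: eq_integral => t _; rewrite /F sum_haxis_dil mulrA mul1e.
rewrite (tilt mX resample (uniq_haxis M) aw1 (F := fun=> 1))// Ex1 mule1 size_haxis.
have -> // : ((1 - a / w)^-1 = w / (w - a))%R.
have wn : w != 0%R by rewrite gt_eqF.
have wan : (w - a)%R != 0%R by rewrite gt_eqF// subr_gt0.
by field; rewrite wan wn.
Qed.

(** The moment of [exp_moment_lpp] for the parameter w', divided by the one for w. *)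
Definition exit_bound (w w' a : R) : R :=
  ((w' / (w' - a)) * ((w - a) / w)) ^+ M *
  (((1 - w) / (1 - w + a)) * ((1 - w' + a) / (1 - w'))) ^+ N.

(** On a horizontal exit the exponential of the last-passage value may be computed with the
    heavier horizontal weights of parameter w' and with arbitrary vertical weights.  The
    vertical weights are scaled so that, once the remaining tilt of the vertical axis has been
    absorbed, the moment is the explicit one for w'. *)
Lemma Ex_exits_hor_le (w w' a : R) : (w < 1)%R -> (0 < a < w')%R -> (w' <= w)%R ->
  Ex (fun v => exits_hor_ind (dil (stat w) v)) <= (exit_bound w w' a)%:E.
Proof.
move=> w1 /andP[a0 aw'] w'w.
have w'0 : (0 < w')%R by exact: lt_trans aw'.
have w0 : (0 < w)%R by exact: lt_le_trans w'w.
have aw : (a < w)%R by exact: lt_le_trans w'w.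
have w01 : (0 < w < 1)%R by rewrite w0.
have w'01 : (0 < w' < 1)%R by rewrite w'0 (le_lt_trans w'w).
have sw : (0 < 1 - w)%R by rewrite subr_gt0.
have sw' : (0 < 1 - w')%R by rewrite subr_gt0 (le_lt_trans w'w).
have swa : (0 < 1 - w + a)%R by rewrite addr_gt0.
have swa' : (0 < 1 - w' + a)%R by rewrite addr_gt0.
have wa : (0 < w - a)%R by rewrite subr_gt0.
have wa' : (0 < w' - a)%R by rewrite subr_gt0.
(* The tilt of the vertical axis multiplies q by (1 - w) / (1 - w + a). *)
pose q := ((1 - w + a) / ((1 - w' + a) * (1 - w)))%R.
pose G (v : env) := (expR (a * lpp (dil (model M N w'^-1 q)%R v) M N))%:E.
have mG : measurable_fun setT G by exact: measurable_exp_lpp.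
have G0 v : 0 <= G v by rewrite lee_fin expR_ge0.
have mD : measurable_fun setT (dil (stat w) : env -> env) by exact: measurable_dil.
have h1 := @exits_hor_le_tilt w a w01 ltac:(by rewrite a0).
have h2 : Ex (fun v => exits_hor_ind (dil (stat w) v) *
    (expR (a * \sum_(z <- haxis M) sweep (grid M N) (dil (stat w) v) z))%:E) <=
    Ex (fun v => G v * (expR (- a * \sum_(z <- vaxis N) dil (stat w) v z))%:E).
  apply: (le_Ex (F := fun v => exits_hor_ind (dil (stat w) v) *
    (expR (a * \sum_(z <- haxis M) sweep (grid M N) (dil (stat w) v) z))%:E)
    (G := fun v => G v * (expR (- a * \sum_(z <- vaxis N) dil (stat w) v z))%:E)).
  - apply: emeasurable_funM; first exact: (measurableT_comp measurable_exits_hor_ind mD).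
    apply: measurable_expRE; apply: measurable_funM => //.
    exact: (measurableT_comp (@measurable_sum_env R _) (measurableT_comp (@measurable_sweep R _) mD)).
  - apply: emeasurable_funM => //.
    apply: measurable_expRE; apply: measurable_funM => //.
    exact: (measurableT_comp (@measurable_sum_env R _) mD).
  - by move=> v; rewrite mule_ge0 ?exits_hor_ind_ge0// lee_fin expR_ge0.
  - move=> v v0; rewrite /exits_hor_ind.
    case: (boolP (exits_hor (steps_left (dil (stat w) v)) M N)) => [ex|_]; last first.
      by rewrite mul0e mule_ge0// lee_fin expR_ge0.
    rewrite mul1e /G -EFinM -expRD lee_fin ler_expR sum_haxis_sweep; last first.
      by rewrite /dil model00 mul0r.
    rewrite mulrBr mulNr lerD2r ler_pM2l//.
    apply: ler_lpp_exits_hor ex => [i iM|i j iM jN].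
      rewrite /dil !model_hor; case: ifP => // _.
      by rewrite ler_wpM2r// lef_pV2.
    have ij : inner (i, j) by rewrite /inner; case/andP: iM => -> _; case/andP: jN.
    by rewrite /dil (model_inner _ _ _ _ ij) (model_inner _ _ _ _ ij).
have := le_trans h1 h2; rewrite (tilt_vaxis w01 a0 mG G0).
have -> : Ex (fun v => G (dil (dil_on (vaxis N) ((1 - w) / (1 - w + a))%R) v)) =
    Ex (fun v => (expR (a * lpp (dil (model M N w'^-1 (1 - w' + a)^-1)%R v) M N))%:E).
  apply: eq_integral => t _; rewrite /G dil_model_vaxis.
  suff -> : (q * ((1 - w) / (1 - w + a)) = (1 - w' + a)^-1)%R by [].
  rewrite /q; field; rewrite !gt_eqF//.
have := @exp_moment_lpp w' a w'01 ltac:(by rewrite a0).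
set E := Ex (fun v => (expR (a * lpp (dil (model M N w'^-1 (1 - w' + a)^-1)%R v) M N))%:E).
set I := Ex (fun v => exits_hor_ind (dil (stat w) v)).
move=> HE HI.
have p1 : (0 < (w / (w - a)) ^+ M)%R by rewrite exprn_gt0// divr_gt0.
have p2 : (0 < ((1 - w) / (1 - w + a)) ^+ N)%R by rewrite exprn_gt0// divr_gt0.
have p3 : (0 < ((1 - w') / (1 - w' + a)) ^+ N)%R by rewrite exprn_gt0// divr_gt0.
have EE : E = ((w' / (w' - a)) ^+ M / ((1 - w') / (1 - w' + a)) ^+ N)%:E.
  move: HE p3; move: (((1 - w') / (1 - w' + a)) ^+ N)%R => p HE p3.
  transitivity ((p^-1)%R%:E * (p%:E * E)).
    by rewrite muleA -EFinM mulVf ?mul1e// gt_eqF.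
  by rewrite HE -EFinM mulrC.
move: HI; rewrite EE -EFinM.
have -> : exit_bound w w' a = (((w / (w - a)) ^+ M)^-1 * (((1 - w) / (1 - w + a)) ^+ N *
    ((w' / (w' - a)) ^+ M / ((1 - w') / (1 - w' + a)) ^+ N)))%R.
  rewrite /exit_bound -!exprVn !invf_div !exprMn; ring.
move=> HI.
rewrite -(@lee_pmul2l _ ((w / (w - a)) ^+ M)%:E) ?lte_fin//.
by rewrite -EFinM mulrA mulfV ?mul1r// gt_eqF.
Qed.

End exit_bound.

(** * Increments without boundary *)

Section increments.
Variable R : realType.
Local Notation env := (env R).
Local Notation exp1 := (exp1 R).
Local Open Scope ereal_scope.

Lemma exp1_race_prob (w : R) : (0 < w < 1)%R ->
  \int[exp1]_x \int[exp1]_y (((x / w <= y / (1 - w))%R)%:R : R)%:E = w%:E.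
Proof.
move=> /andP[w0 w1]; have s0 : (0 < 1 - w)%R by rewrite subr_gt0.
pose b (z : R * R) := (z.1 <= z.2)%R.
have mb : measurable_fun setT (fun z : R * R => (b z)%:R%:E : \bar R).
  by apply: measurable_boolE; exact: measurable_fun_ler.
have b0 z : 0 <= ((b z)%:R%:E : \bar R) by rewrite lee_fin ler0n.
have ws : (w + (1 - w) = 1)%R by rewrite addrC subrK.
have h := @exp1_race R w (1 - w)%R (fun z => (b z)%:R%:E) w0 s0 ws mb b0.
etransitivity; first exact: h.
have I1 (f : R -> \bar R) : (forall x, (0 <= x)%R -> f x = 1) ->
    measurable_fun setT f -> (forall x, 0 <= f x) -> \int[exp1]_x f x = 1.
  move=> f1 mf f0; rewrite (@eq_integral_exp1 R f (fun=> 1)) //.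
  by rewrite integral_cst// mul1e; exact: probability_setT.
have -> : \int[exp1]_p \int[exp1]_y (b (p, (p + y / (1 - w))%R))%:R%:E = 1 :> \bar R.
  transitivity (\int[exp1]_p (1 : \bar R)); last first.
    by rewrite integral_cst// mul1e; exact: probability_setT.
  apply: eq_integral => p _; apply: I1 => //.
  - by move=> y y0; rewrite /b /= lerDl divr_ge0// ltW.
  - apply: (measurableT_comp mb); apply: measurable_fun_pair => //.
    by apply: measurable_funD => //; exact: measurable_funM.
have -> : \int[exp1]_q \int[exp1]_x (b ((q + x / w)%R, q))%:R%:E = 0 :> \bar R.
  apply: integral0_eq => q _.
  have mq : measurable_fun setT (fun x : R => (b ((q + x / w)%R, q))%:R%:E : \bar R).
    apply: (measurableT_comp mb); apply: measurable_fun_pair => //.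
    by apply: measurable_funD => //; exact: measurable_funM.
  transitivity (\int[exp1]_x (\1_[set 0%R] x : R)%:E); last first.
    by rewrite integral_indic// setIT; exact: exp1_set1.
  apply: eq_integral_exp1 => //.
  - by apply/measurable_EFinP; exact: measurable_indic.
  move=> x x0; rewrite /b /= gerDl pmulr_lle0 ?invr_gt0// indicE.
  suff -> : (x <= 0)%R = (x \in [set 0%R]) by [].
  apply/idP/idP => [xn|/set_mem/= -> //].
  by apply/mem_set => /=; apply/eqP; rewrite eq_le xn x0.
by rewrite mule0 add0e mule1.
Qed.

Variables (d : measure_display) (T : measurableType d) (P : probability T R).
Variable X : T -> env.
Hypothesis mX : measurable_fun setT X.
Hypothesis X0 : forall t z, (0 <= X t z)%R.
Hypothesis resample : forall z (F : env -> \bar R),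
  measurable_fun setT F -> (forall v, 0 <= F v) ->
  \int[P]_t F (X t) = \int[P]_t \int[exp1]_x F (upd (X t) z x).

Local Notation Ex F := (\int[P]_t F (X t)).
Variables M N : nat.
Local Notation stat w := (model M.+1 N.+1 w^-1%R (1 - w)^-1%R).

Definition from_left (v : nat * nat -> R) : bool := (lpp v M.+1 N <= lpp v M N.+1)%R.

Lemma measurable_from_left : measurable_fun setT (from_left : env -> bool).
Proof. exact: measurable_fun_ler (measurable_lpp _ _) (measurable_lpp _ _). Qed.

Lemma measurable_zero_axes : measurable_fun setT (@zero_axes R : env -> env).
Proof.
apply: measurable_env => z; rewrite /zero_axes.
by case: (_ || _); [exact: measurable_cst|exact: measurable_coord].
Qed.

(** After the sweep the two increments at the corner are axis entries, whose law is that of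
    the axis entries before the sweep. *)
Lemma from_left_stationary (w : R) : (0 < w < 1)%R ->
  Ex (fun v => (from_left (dil (stat w) v))%:R%:E : \bar R) = w%:E.
Proof.
move=> w01.
pose a := (M.+1, 0)%N; pose b := (0, N.+1)%N.
pose F (u : env) : \bar R := (((u a <= u b)%R)%:R)%:E.
have mF : measurable_fun setT F.
  by apply: measurable_boolE; apply: measurable_fun_ler; exact: measurable_coord.
have F0 u : 0 <= F u by rewrite lee_fin ler0n.
transitivity (Ex (fun v => F (sweep (grid M.+1 N.+1) (dil (stat w) v)))).
  apply: eq_integral => t _; rewrite /F /from_left.
  have [h v] := sweep_grid (dil (stat w) (X t)) M.+1 N.+1.
  by rewrite h ?v ?ltnSn//= lerD2l lerN2.
rewrite (stationary_grid resample M.+1 N.+1 w01 mF F0).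
have mFD : measurable_fun setT (fun v : env => F (dil (stat w) v)).
  exact: (measurableT_comp mF (@measurable_dil R _)).
rewrite (resample2 resample a b mFD (fun=> F0 _)).
transitivity (\int[P]_t (w%:E : \bar R)); last first.
  rewrite integral_cst//; etransitivity; last exact: mule1.
  by apply: (f_equal (mule _)); exact: probability_setT.
apply: eq_integral => t _; etransitivity; last exact: (exp1_race_prob w01).
apply: eq_integral => x _; apply: eq_integral => y _.
rewrite /F /dil model_hor model_ver !ltnSn /= /upd eqxx /=.
by rewrite eqxx (mulrC _ x) (mulrC _ y).
Qed.

(** Integrates [steps_left_zero_axes]. *)
Lemma from_left_bulk (w w' a : R) : (w < 1)%R -> (0 < a < w')%R -> (w' <= w)%R ->
  Ex (fun v => (from_left (zero_axes v))%:R%:E : \bar R) <=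
  (w + exit_bound M.+1 N.+1 w w' a)%:E.
Proof.
move=> w1 aw' w'w.
have w01 : (0 < w < 1)%R.
  by rewrite w1 andbT; case/andP: aw' => a0 aw'; lra.
have mD : measurable_fun setT (dil (stat w) : env -> env) by exact: measurable_dil.
have mfl := measurable_from_left.
pose F1 (v : env) : \bar R := exits_hor_ind M.+1 N.+1 (dil (stat w) v).
pose F2 (v : env) : \bar R := (from_left (dil (stat w) v))%:R%:E.
have mF1 : measurable_fun setT F1 by exact: (measurableT_comp (@measurable_exits_hor_ind R _ _) mD).
have mF2 : measurable_fun setT F2.
  by apply: measurable_boolE; exact: (measurableT_comp mfl mD).
have F10 v : 0 <= F1 v by exact: exits_hor_ind_ge0.
have F20 v : 0 <= F2 v by rewrite lee_fin ler0n.
apply: (@le_trans _ _ (Ex (fun v => F1 v + F2 v))).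
  apply: (@le_Ex R d T P X mX X0 (fun v => (from_left (zero_axes v))%:R%:E)
    (fun v => F1 v + F2 v)).
  - by apply: measurable_boolE; exact: (measurableT_comp mfl measurable_zero_axes).
  - exact: emeasurable_funD.
  - by move=> v; rewrite lee_fin ler0n.
  move=> v v0; rewrite /F1 /F2 /exits_hor_ind -(zero_axes_dil M.+1 N.+1 w^-1 (1 - w)^-1).
  set u := dil _ _.
  have u0 z : (0 <= u z)%R.
    rewrite /u /dil mulr_ge0// /model; do !case: ifP => //= _;
    by rewrite invr_ge0; lra.
  have u00 : u (0, 0)%N = 0%R by rewrite /u /dil model00 mul0r.
  have := @steps_left_zero_axes R u M N u0 u00.
  rewrite -EFinD lee_fin -natrD ler_nat /from_left.
  case: (lpp (zero_axes u) M.+1 N <= _)%R => // /(_ isT).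
  by case: exits_hor => //= ->.
rewrite (@ge0_integralD _ T R P setT measurableT (F1 \o X) (F2 \o X)
  (fun t _ => F10 _) (measurableT_comp mF1 mX) (fun t _ => F20 _) (measurableT_comp mF2 mX)).
rewrite addeC EFinD; apply: leeD.
  by rewrite -(from_left_stationary w01).
exact: (Ex_exits_hor_le mX X0 resample M.+1 N.+1 w1 aw' w'w).
Qed.

End increments.

(** * Geodesics and the competition interface *)

Section last_passage_recursion.
Variable R : realType.
Variable w : nat * nat -> R.
Local Open Scope ereal_scope.
Local Notation LP := (last_passage w).

Lemma up_right_path_le u s : path up_right_step u s ->
  [/\ (u.1 <= (last u s).1)%N, (u.2 <= (last u s).2)%N &
      ((last u s).1 + (last u s).2 = size s + (u.1 + u.2))%N].
Proof.
elim: s u => [|c s IH] u //= /andP[uc /IH[h1 h2 h3]].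
by case/orP: uc => /eqP E; move: h1 h2 h3; rewrite E /=; split; lia.
Qed.

Lemma last_passage_self u : LP u u = (w u)%:E.
Proof.
rewrite /last_passage (_ : [set _ | _ in _] = [set (w u)%:E]) ?ereal_sup1//.
apply/seteqP; split=> [_ [_ [s [-> ps su]] <-]|_ ->] /=.
  have [_ _] := up_right_path_le ps; rewrite su => h.
  have /size0nil -> : size s = 0%N by lia.
  by rewrite /path_weight big_seq1.
by exists [:: u]; [exists nil|rewrite /path_weight big_seq1].
Qed.

Lemma last_passage_out u v : ~~ ((u.1 <= v.1) && (u.2 <= v.2))%N -> LP u v = -oo.
Proof.
move=> uv; rewrite /last_passage (_ : [set _ | _ in _] = set0) ?ereal_sup0//.
apply/seteqP; split=> // _ [_ [s [-> ps su]] <-]; move: uv.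
by have [h1 h2 _] := up_right_path_le ps; rewrite -su h1 h2.
Qed.

Lemma last_passage_ub u v p : up_right_paths u v p ->
  (path_weight w p)%:E <= LP u v.
Proof. by move=> pp; apply: ereal_sup_ubound; exists p. Qed.

Lemma up_right_paths_rcons u i j p' x :
  x = (i, j.+1) \/ x = (i.+1, j) ->
  up_right_paths u x p' -> up_right_paths u (i.+1, j.+1) (rcons p' (i.+1, j.+1)).
Proof.
move=> xE [s [-> ps sx]]; exists (rcons s (i.+1, j.+1)).
rewrite rcons_cons rcons_path last_rcons ps sx /=; split=> //.
by case: xE => ->; rewrite /up_right_step !eqxx ?orbT.
Qed.

Lemma up_right_paths_rconsP u i j p : u != (i.+1, j.+1) ->
  up_right_paths u (i.+1, j.+1) p ->
  exists p' x, [/\ x = (i, j.+1) \/ x = (i.+1, j), up_right_paths u x p' &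
    p = rcons p' (i.+1, j.+1)].
Proof.
move=> ux [s [-> ps sx]]; elim/last_ind: s ps sx => [_ /= ux'|s c _].
  by rewrite ux' eqxx in ux.
rewrite rcons_path last_rcons => /andP[ps +] cE; rewrite cE => st.
exists (u :: s), (last u s); split=> //; last by exists s.
case/orP: st => /eqP; case: (last u s) => a b /= [-> ->]; by [left|right].
Qed.

Lemma path_weight_rcons p z : path_weight w (rcons p z) = (path_weight w p + w z)%R.
Proof. by rewrite /path_weight big_rcons. Qed.

Lemma last_passage_last u i j : u != (i.+1, j.+1) ->
  LP u (i.+1, j.+1) = (w (i.+1, j.+1))%:E + maxe (LP u (i, j.+1)) (LP u (i.+1, j)).
Proof.
move=> ux; apply/eqP; rewrite eq_le; apply/andP; split.
  apply: ge_ereal_sup => _ [p pp <-].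
  have [p' [x [xE pp' ->]]] := up_right_paths_rconsP ux pp.
  rewrite path_weight_rcons EFinD addeC leeD2l//.
  have := last_passage_ub pp'; rewrite le_max => h.
  by case: xE => <-; rewrite h ?orbT.
rewrite -leeBrDl// ge_max; apply/andP; split; apply: ge_ereal_sup => _ [p pp <-].
  rewrite leeBrDl// -EFinD addrC -path_weight_rcons.
  by apply: last_passage_ub; apply: up_right_paths_rcons pp; left.
rewrite leeBrDl// -EFinD addrC -path_weight_rcons.
by apply: last_passage_ub; apply: up_right_paths_rcons pp; right.
Qed.

Lemma last_passage_first u v : u != v ->
  LP u v = (w u)%:E + maxe (LP (u.1.+1, u.2) v) (LP (u.1, u.2.+1) v).
Proof.
move=> uv; apply/eqP; rewrite eq_le; apply/andP; split.
  apply: ge_ereal_sup => _ [_ [[|c s] [-> /= ps sv]] <-].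
    by rewrite sv eqxx in uv.
  case/andP: ps => uc ps; rewrite /path_weight big_cons EFinD leeD2l//.
  have pp : up_right_paths c v (c :: s) by exists s.
  have := last_passage_ub pp; rewrite le_max => h.
  by case/orP: uc => /eqP <-; rewrite h ?orbT.
have ub c : up_right_step u c -> LP c v <= LP u v - (w u)%:E.
  move=> uc; apply: ge_ereal_sup => _ [_ [s [-> ps sv]] <-].
  rewrite leeBrDl// -EFinD.
  have pp : up_right_paths u v (u :: c :: s) by exists (c :: s); rewrite /= uc.
  by have := last_passage_ub pp; rewrite {1}/path_weight big_cons.
rewrite -leeBrDl// ge_max; apply/andP; split; apply: ub.
  by rewrite /up_right_step eqxx.
by rewrite /up_right_step eqxx orbT.
Qed.

Definition shift_env (v : nat * nat -> R) : nat * nat -> R := fun z => v (z.1.+1, z.2.+1).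

Lemma last_passage_lpp i j : LP (1, 1)%N (i.+1, j.+1) = (lpp (shift_env w) i j)%:E.
Proof.
have [n] := ubnP (i + j); elim: n i j => // n IH [|i] [|j] ltn.
- by rewrite last_passage_self.
- rewrite last_passage_last // (@last_passage_out _ (0, _)%N)// max_r ?leNye//.
  by rewrite (IH 0%N j) ?lpp0S//; lia.
- rewrite last_passage_last // (@last_passage_out _ (_, 0)%N)// max_l ?leNye//.
  by rewrite (IH i 0%N) ?lppS0//; lia.
- rewrite last_passage_last // (IH i j.+1) ?(IH i.+1 j) ?lppSS; try lia.
  by rewrite -EFin_max.
Qed.

(** Seen from its end point, the last-passage value is the one of the reflected
    environment; nonnegativity lets zero axes stand for unavailable steps. *)
Lemma last_passage_reflect M N (v : nat * nat -> R) i j :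
  (forall k l, (0 < k <= M)%N -> (0 < l <= N)%N ->
     v (k, l) = w (M.+1 - k, N.+1 - l)%N) ->
  (forall z, 0 <= v z)%R -> (i < M)%N -> (j < N)%N ->
  LP (M - i, N - j)%N (M, N) = (lpp (zero_axes v) i.+1 j.+1)%:E.
Proof.
move=> vw v0.
have za0 z : (0 <= zero_axes v z)%R by rewrite /zero_axes; case: ifP.
have ax1 k : lpp (zero_axes v) k 0 = 0%R.
  by elim: k => [|k IHk]; rewrite ?lpp00 ?lppS0 ?IHk /zero_axes /= ?orbT ?addr0.
have ax2 k : lpp (zero_axes v) 0 k = 0%R.
  by elim: k => [|k IHk]; rewrite ?lpp00 ?lpp0S ?IHk /zero_axes /= ?orbT ?addr0.
have [n] := ubnP (i + j); elim: n i j => // n IH i j ltn iM jN.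
have e : zero_axes v (i.+1, j.+1) = w (M - i, N - j)%N.
  by rewrite /zero_axes /= vw // !subSS.
have [[i0 j0]|ne] := eqVneq (i, j) (0, 0)%N.
  by rewrite i0 j0 in e *; rewrite !subn0 last_passage_self lppSS ax1 ax2 maxxx addr0 e !subn0.
rewrite last_passage_first; last by rewrite xpair_eqE; move: ne; rewrite xpair_eqE; lia.
rewrite lppSS e EFinD /=; apply: (f_equal (adde _)).
case: i ltn iM ne e => [|i] ltn iM ne e.
  rewrite last_passage_out /=; last by lia.
  rewrite max_r ?leNye// ax2 max_r; last by apply: lpp_ge0.
  case: j ltn jN ne e => [|j] ltn jN ne e; first by move: ne; rewrite eqxx.
  by rewrite subnSK ?(ltnW jN)//; apply: (IH 0%N j) => //; lia.
case: j ltn jN ne e => [|j] ltn jN ne e.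
  rewrite [X in maxe _ X]last_passage_out /=; last by lia.
  rewrite max_l ?leNye// ax1 max_l; last by apply: lpp_ge0.
  by rewrite subnSK ?(ltnW iM)//; apply: (IH i 0%N) => //; lia.
rewrite !subnSK ?(ltnW iM) ?(ltnW jN)// EFin_max; apply: (f_equal2 maxe).
  by apply: (IH i j.+1) => //; lia.
by apply: (IH i.+1 j) => //; lia.
Qed.

End last_passage_recursion.

Section interface.
Variable R : realType.
Variable w : nat * nat -> R.
Local Open Scope ereal_scope.
Local Notation LP := (last_passage w).
Local Notation g := (lpp (shift_env w)).

Definition no_ties : Prop := forall i j, g i j.+1 != g i.+1 j.

Lemma exists_geodesic i j : exists p, is_geodesic w (1, 1)%N (i.+1, j.+1) p.
Proof.
have [n] := ubnP (i + j); elim: n i j => // n IH i j ltn.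
have rcons_geo x p : x = (i, j.+1) \/ x = (i.+1, j) ->
    (w (i.+1, j.+1))%:E + LP (1, 1)%N x = LP (1, 1)%N (i.+1, j.+1) ->
    is_geodesic w (1, 1)%N x p ->
    is_geodesic w (1, 1)%N (i.+1, j.+1) (rcons p (i.+1, j.+1)).
  move=> xE xL [pp pE]; split; first exact: up_right_paths_rcons pp.
  by rewrite path_weight_rcons EFinD addeC pE.
case: i j ltn rcons_geo => [|i] [|j] ltn rg.
- exists [:: (1, 1)%N]; split; first by exists nil.
  by rewrite last_passage_self /path_weight big_seq1.
- have [p pg] := IH 0%N j ltac:(lia); exists (rcons p (1, j.+2)%N).
  by apply: rg pg; [right|rewrite !last_passage_lpp lpp0S EFinD].
- have [p pg] := IH i 0%N ltac:(lia); exists (rcons p (i.+2, 1)%N).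
  by apply: rg pg; [left|rewrite !last_passage_lpp lppS0 EFinD].
have [le|lt] := leP (g i j.+1) (g i.+1 j).
  have [p pg] := IH i.+1 j ltac:(lia); exists (rcons p (i.+2, j.+2)%N).
  by apply: rg pg; [right|rewrite !last_passage_lpp lppSS max_r// EFinD].
have [p pg] := IH i j.+1 ltac:(lia); exists (rcons p (i.+2, j.+2)%N).
by apply: rg pg; [left|rewrite !last_passage_lpp lppSS max_l ?ltW// EFinD].
Qed.

Lemma geodesic_rconsP i j p : (1, 1)%N != (i.+1, j.+1) ->
  is_geodesic w (1, 1)%N (i.+1, j.+1) p ->
  exists p' x, [/\ x = (i, j.+1) \/ x = (i.+1, j), is_geodesic w (1, 1)%N x p',
    p = rcons p' (i.+1, j.+1) &
    LP (1, 1)%N (i, j.+1) <= LP (1, 1)%N x /\ LP (1, 1)%N (i.+1, j) <= LP (1, 1)%N x].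
Proof.
move=> ne [pp pE]; have [p' [x [xE pp' pr]]] := up_right_paths_rconsP ne pp.
move: pE; rewrite pr path_weight_rcons EFinD addeC last_passage_last//.
move=> /(congr1 (fun y => y - (w (i.+1, j.+1))%:E)).
rewrite [_ + (path_weight _ _)%:E]addeC [_ + maxe _ _]addeC !addeK// => pE.
have ub := last_passage_ub w pp'; rewrite pE in ub.
exists p', x; split=> //.
  split=> //; apply/eqP; rewrite eq_le (last_passage_ub w pp') pE le_max.
  by case: xE => <-; rewrite lexx ?orbT.
by move: ub; rewrite ge_max => /andP[].
Qed.

(** Two geodesics to a point must arrive through different neighbours or extend different
    geodesics to the same neighbour, so the first multiple geodesic comes from a tie. *)
Lemma unique_geodesicsP : unique_geodesics w <-> no_ties.
Proof.
split=> [uniq i j|nt].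
  apply/eqP => tie.
  have [p1 g1] := exists_geodesic i j.+1; have [p2 g2] := exists_geodesic i.+1 j.
  pose x := (i.+2, j.+2)%N.
  have [p [_ pu]] : exists! p, is_geodesic w (1, 1)%N x p by apply: uniq; split.
  have h1 : is_geodesic w (1, 1)%N x (rcons p1 x).
    case: g1 => [pp pE]; split; first by apply: up_right_paths_rcons pp; left.
    rewrite path_weight_rcons EFinD pE !last_passage_lpp -EFinD lppSS tie maxxx.
    by rewrite addrC.
  have h2 : is_geodesic w (1, 1)%N x (rcons p2 x).
    case: g2 => [pp pE]; split; first by apply: up_right_paths_rcons pp; right.
    rewrite path_weight_rcons EFinD pE !last_passage_lpp -EFinD lppSS tie maxxx.
    by rewrite addrC.
  have /rcons_inj[p12] : rcons p1 x = rcons p2 x by rewrite -(pu _ h1) -(pu _ h2).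
  have [[s1 [e1 _ l1]] _] := g1; have [[s2 [e2 _ l2]] _] := g2.
  by move: l1; rewrite e1 e2 in p12; case: p12 => ->; rewrite l2 => -[] /eqP; lia.
move=> [i j] [/= i0 j0]; case: i j i0 j0 => // i [|j] // _ _.
have [n] := ubnP (i + j); elim: n i j => // n IH i j ltn.
have [p pg] := exists_geodesic i j; exists p; split=> // q qg.
have [e11|ne] := eqVneq (1, 1)%N (i.+1, j.+1).
  have self r : is_geodesic w (1, 1)%N (i.+1, j.+1) r -> r = [:: (1, 1)%N].
    move=> [[s [-> ps su]] _]; have [_ _] := up_right_path_le ps.
    by rewrite su -e11 => h; have /size0nil -> : size s = 0%N by lia.
  by rewrite (self _ pg) (self _ qg).
have [p' [x [xE pg' -> [px1 px2]]]] := geodesic_rconsP ne pg.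
have [q' [y [yE qg' -> [qy1 qy2]]]] := geodesic_rconsP ne qg.
have quad z r : is_geodesic w (1, 1)%N z r -> (0 < z.1)%N && (0 < z.2)%N.
  by move=> [[s [_ ps sz]] _]; have [+ + _] := up_right_path_le ps; rewrite sz /= => -> ->.
have xy : x = y.
  have := quad _ _ pg'; have := quad _ _ qg'.
  case: xE px1 px2 => -> px1 px2; case: yE qy1 qy2 => -> qy1 qy2 // c1 c2.
    case: i j nt {IH ltn p pg q qg ne p' pg' q' qg'} px1 px2 qy1 qy2 c1 c2 => [|i] [|j] // nt.
    rewrite !last_passage_lpp !lee_fin => _ h1 h2 _ _ _.
    by have := nt i j; rewrite eq_le h1 h2.
  case: i j nt {IH ltn p pg q qg ne p' pg' q' qg'} px1 px2 qy1 qy2 c1 c2 => [|i] [|j] // nt.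
  rewrite !last_passage_lpp !lee_fin => h1 _ _ h2 _ _.
  by have := nt i j; rewrite eq_le h1 h2.
rewrite -xy in qg'.
congr rcons; have := quad _ _ pg'; case: x xE pg' qg' {px1 px2 qy1 qy2 xy quad} => a b xE pg' qg'.
case: a b xE pg' qg' => // a [|b] // xE pg' qg' _.
have [|r [_ ru]] := IH a b; first by case: xE => -[]; lia.
by rewrite -(ru _ pg') -(ru _ qg').
Qed.

Local Notation h := (exits_hor (steps_left (shift_env w))).

(** The three last-passage values obey the same recursion, and in the absence of ties the
    larger neighbour decides all of them simultaneously. *)
Lemma compare_first_steps i j : no_ties -> (i, j) != (0, 0)%N ->
  let x := (i.+1, j.+1) in
  if h i j then
    (w (1, 1)%N)%:E + LP (2, 1)%N x = (g i j)%:E /\ (w (1, 1)%N)%:E + LP (1, 2)%N x < (g i j)%:E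
  else
    (w (1, 1)%N)%:E + LP (2, 1)%N x < (g i j)%:E /\ (w (1, 1)%N)%:E + LP (1, 2)%N x = (g i j)%:E.
Proof.
move=> nt /=; have [n] := ubnP (i + j); elim: n i j => // n IH [|i] [|j] ltn // ne.
- rewrite exits_hor0j (@last_passage_out _ _ (2, 1)%N) //.
  split; first by rewrite addeNy ltNye.
  case: j ltn ne => [|j] ltn ne; first by rewrite last_passage_self lpp0S lpp00 /shift_env/= -EFinD addrC.
  have := IH 0%N j.+1 ltac:(lia) isT; move=> -[_ IH'].
  rewrite last_passage_last // (@last_passage_out _ _ (1, 2)%N (0, _)%N) // max_r ?leNye//.
  by rewrite addeCA IH' -EFinD.
- rewrite exits_hori0 (@last_passage_out _ _ (1, 2)%N) //.
  split; last by rewrite addeNy ltNye.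
  case: i ltn ne => [|i] ltn ne; first by rewrite last_passage_self lppS0 lpp00 /shift_env/= -EFinD addrC.
  have := IH i.+1 0%N ltac:(lia) isT; move=> -[IH' _].
  rewrite last_passage_last // (@last_passage_out _ _ (2, 1)%N (_, 0)%N) // max_l ?leNye//.
  by rewrite addeCA IH' -EFinD.
have H1 := IH i j.+1 ltac:(lia) ltac:(by rewrite xpair_eqE andbF); have H2 := IH i.+1 j ltac:(lia) isT.
rewrite (@last_passage_last R w (2, 1)%N i.+1 j.+1); last by rewrite xpair_eqE; lia.
rewrite (@last_passage_last R w (1, 2)%N i.+1 j.+1); last by rewrite xpair_eqE; lia.
rewrite exits_horSS lppSS /steps_left /=.
have -> : shift_env w (i.+1, j.+1) = w (i.+2, j.+2) by [].
rewrite ![(w (1, 1)%N)%:E + (_ + _)]addeCA !adde_maxr//.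
have := nt i j; rewrite neq_lt => /orP[lt|lt].
  rewrite (ltNge (g i.+1 j)) (ltW lt) /= (max_r (ltW lt)).
  have lt' : (g i j.+1)%:E < (g i.+1 j)%:E by rewrite lte_fin.
  have [A1 B1] : (w (1, 1)%N)%:E + LP (2, 1)%N (i.+1, j.+2) < (g i.+1 j)%:E /\
      (w (1, 1)%N)%:E + LP (1, 2)%N (i.+1, j.+2) < (g i.+1 j)%:E.
    by move: H1; case: ifP => _ [E1 E2]; split; rewrite ?E1 ?E2//; apply: lt_trans lt'.
  rewrite EFinD; move: H2; case: ifP => _ [E1 E2]; split.
  - by rewrite -adde_maxr// E1 max_r // ltW.
  - by rewrite -adde_maxr// lteD2lE// gt_max B1 E2.
  - by rewrite -adde_maxr// lteD2lE// gt_max A1 E1.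
  - by rewrite -adde_maxr// E2 max_r // ltW.
rewrite lt (max_l (ltW lt)).
have lt' : (g i.+1 j)%:E < (g i j.+1)%:E by rewrite lte_fin.
have [A1 B1] : (w (1, 1)%N)%:E + LP (2, 1)%N (i.+2, j.+1) < (g i j.+1)%:E /\
    (w (1, 1)%N)%:E + LP (1, 2)%N (i.+2, j.+1) < (g i j.+1)%:E.
  by move: H2; case: ifP => _ [E1 E2]; split; rewrite ?E1 ?E2//; apply: lt_trans lt'.
rewrite EFinD; move: H1; case: ifP => _ [E1 E2]; split.
- by rewrite -adde_maxr// E1 max_l // ltW.
- by rewrite -adde_maxr// lteD2lE// gt_max B1 E2.
- by rewrite -adde_maxr// lteD2lE// gt_max A1 E1.
- by rewrite -adde_maxr// E2 max_l // ltW.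
Qed.

Lemma T_horP i j : no_ties -> (i, j) != (0, 0)%N -> T_hor w (i.+1, j.+1) <-> h i j.
Proof.
move=> nt ne; have := compare_first_steps nt ne; rewrite /T_hor /=.
case: ifP => hij [E1 E2]; split=> //; last first.
  by move=> [_]; rewrite -(@lteD2lE _ (w (1, 1)%N)%:E)// E2 ltNge ltW.
by move=> _; split=> //; rewrite -(@lteD2lE _ (w (1, 1)%N)%:E)// E1.
Qed.

Lemma T_verP i j : no_ties -> (i, j) != (0, 0)%N -> T_ver w (i.+1, j.+1) <-> ~~ h i j.
Proof.
move=> nt ne; have := compare_first_steps nt ne; rewrite /T_ver /=.
case: ifP => hij [E1 E2]; split=> //.
  by move=> [_]; rewrite -(@lteD2lE _ (w (1, 1)%N)%:E)// E1 ltNge ltW.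
by move=> _; split=> //; rewrite -(@lteD2lE _ (w (1, 1)%N)%:E)// E2.
Qed.

(** On each antidiagonal the points of [T_hor] form a terminal segment; the interface
    passes just before its smallest element. *)
Lemma competition_interfaceP : no_ties ->
  is_competition_interface w (competition_interface w).
Proof.
move=> nt; rewrite /competition_interface.
suff [phi phiP] : exists phi, is_competition_interface w phi.
  by case: xgetP => [f _ //|/(_ phi)].
have : forall n, exists z : nat * nat, (0 < n)%N ->
    [/\ quadrant z, T_hor w (z.1.+1, z.2), T_ver w (z.1, z.2.+1) & (z.1 + z.2 = n.+1)%N].
  move=> [|n]; first by exists (0, 0)%N.
  have ex : exists a, (a <= n.+1)%N && h a (n.+1 - a).
    by exists n.+1; rewrite leqnn subnn exits_hori0.
  case: (ex_minnP ex) => -[|a] /andP[an ha] amin; first by rewrite exits_hor0j in ha.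
  exists (a.+1, (n - a).+1) => _; split=> //=.
  - by apply/T_horP => //; move: ha; rewrite subSS.
  - apply/T_verP => //; first by rewrite xpair_eqE; lia.
    apply/negP => ha'; have := amin a; rewrite subSn ?ha' ?andbT; last by lia.
    by rewrite (leq_trans _ an) // => /(_ isT); rewrite ltnn.
  - by lia.
by move=> /choice[phi phiP]; exists phi.
Qed.

Lemma phi_hor_le n k : no_ties -> (0 < n)%N -> (k <= n)%N ->
  (phi_hor w n <= k)%N = h k (n - k).
Proof.
move=> nt n0 kn; rewrite /phi_hor.
have := competition_interfaceP nt n0.
case: (competition_interface w n) => -[|a] [|b] [] [/= // _ _] Th Tv ab.
have ha : h a.+1 b by apply/T_horP.
have hb : ~~ h a b.+1 by apply/T_verP => //; rewrite xpair_eqE andbF.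
apply/idP/idP => [ak|hk].
  have := @exits_hor_antidiagD (steps_left (shift_env w)) a.+1 (n - k) (k - a.+1).
  have -> : (n - k + (k - a.+1) = b)%N by lia.
  by rewrite subnKC// => /(_ ha).
rewrite ltnNge; apply: contra hb => ka.
have := @exits_hor_antidiagD (steps_left (shift_env w)) k b.+1 (a - k).
have -> : (b.+1 + (a - k) = n - k)%N by lia.
by rewrite subnKC// => /(_ hk).
Qed.

Lemma phi_ver_le n k : no_ties -> (0 < n)%N -> (k <= n)%N ->
  (phi_ver w n <= k)%N = ~~ h (n - k) k.
Proof.
move=> nt n0 kn.
have := phi_hor_le nt n0 (leq_subr k n); rewrite subKn// => <-.
have := competition_interfaceP nt n0; rewrite /phi_ver /phi_hor.
by case: (competition_interface w n) => a b [_ _ _ /=]; lia.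
Qed.

End interface.

(** * From the weights to the environment *)

Lemma measure_indic d (T : measurableType d) (R : realType)
    (m : {measure set T -> \bar R}) (A : set T) : measurable A ->
  m A = (\int[m]_x (\1_A x)%:E)%E.
Proof. by move=> mA; rewrite integral_indic// setIT. Qed.

Lemma lpp_upd_out (R : realType) (v : nat * nat -> R) z x i j :
  ~~ ((z.1 <= i) && (z.2 <= j))%N -> lpp (upd v z x) i j = lpp v i j.
Proof.
move=> zij; apply: lpp_local => z' z'i z'j; rewrite /upd; case: eqP => // z'z.
by move: zij; rewrite -z'z z'i z'j.
Qed.

Lemma lpp_upd (R : realType) (v : nat * nat -> R) i j x :
  lpp (upd v (i, j) x) i j = lpp v i j - v (i, j) + x.
Proof.
case: i j => [|i] [|j].
- by rewrite !lpp00 /upd eqxx subrr add0r.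
- by rewrite !lpp0S lpp_upd_out /= ?ltnn// {1}/upd eqxx; ring.
- by rewrite !lppS0 lpp_upd_out /= ?ltnn// {1}/upd eqxx; ring.
by rewrite !lppSS !lpp_upd_out /= ?ltnn ?andbF// {1}/upd eqxx; ring.
Qed.

(** Inside the window this is the reflection exchanging the corners.  Other indices are sent
    injectively to weights outside the window, which supply the independent boundary. *)
Definition reflect_index M N (z : nat * nat) : nat * nat :=
  if (0 < z.1 <= M)%N && (0 < z.2 <= N)%N then (M.+1 - z.1, N.+1 - z.2)%N
  else (M.+1 + z.1, N.+1 + z.2)%N.

Definition reflect_index_inv M N (z : nat * nat) : nat * nat :=
  if (z.1 <= M)%N && (z.2 <= N)%N then (M.+1 - z.1, N.+1 - z.2)%N
  else (z.1 - M.+1, z.2 - N.+1)%N.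

Lemma reflect_indexK M N : cancel (reflect_index M N) (reflect_index_inv M N).
Proof.
move=> [i j]; rewrite /reflect_index /=; case: ifPn => ij;
  rewrite /reflect_index_inv /=; case: ifPn => ij'; congr pair; lia.
Qed.

Lemma reflect_index_quadrant M N z : quadrant (reflect_index M N z).
Proof.
by rewrite /quadrant /reflect_index; case: ifPn => ij /=; split; lia.
Qed.

Definition swap_index (z : nat * nat) : nat * nat := (z.2, z.1).

Lemma lpp_swap (R : realType) (v : nat * nat -> R) i j :
  lpp (fun z => v (swap_index z)) i j = lpp v j i.
Proof.
have [n] := ubnP (i + j); elim: n i j => // n IH [|i] [|j] ltn //.
- by rewrite lpp0S lppS0 (IH 0%N j).
- by rewrite lpp0S lppS0 (IH i 0%N).
- by rewrite !lppSS maxC (IH i j.+1) ?(IH i.+1 j)//; lia.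
Qed.

(** Turns the competition at the starting point into one at the far corner. *)
Lemma first_steps_reflected (R : realType) (w : nat * nat -> R) k l :
  (forall z, quadrant z -> 0 <= w z) ->
  let v := zero_axes (fun z => `|w (reflect_index k.+2 l.+2 z)|) in
  last_passage w (2, 1)%N (k.+2, l.+2) = (lpp v k.+1 l.+2)%:E /\
  last_passage w (1, 2)%N (k.+2, l.+2) = (lpp v k.+2 l.+1)%:E.
Proof.
move=> w0 /=.
have vw a b : (0 < a <= k.+2)%N -> (0 < b <= l.+2)%N ->
    `|w (reflect_index k.+2 l.+2 (a, b))| = w (k.+3 - a, l.+3 - b)%N.
  move=> ak bl; rewrite /reflect_index /= ak bl /= ger0_norm//.
  by apply: w0; split=> /=; lia.
have H := @last_passage_reflect R w k.+2 l.+2 _ _ _ vw (fun z => normr_ge0 _).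
split.
  rewrite -H ?ltnS ?leqnSn//; congr last_passage; congr pair; lia.
rewrite -H ?ltnS ?leqnSn//; congr last_passage; congr pair; lia.
Qed.

Section weights.
Variable R : realType.
Local Notation env := (env R).
Variables (d : measure_display) (T : measurableType d) (P : probability T R).
Variable omega : nat * nat -> {RV P >-> R}.
Hypothesis iid : iid_exponential_weights omega.
Local Open Scope ereal_scope.

Lemma exp1_normr (A : set R) : measurable A ->
  exp1 R ((fun x : R => `|x|%R) @^-1` A) = exp1 R A.
Proof.
move=> mA.
have mB : measurable ((fun x : R => `|x|%R) @^-1` A).
  by rewrite -[X in measurable X]setTI; exact: (@normr_measurable R setT measurableT).
rewrite !measure_indic//; apply: eq_integral_exp1 => //.
- by apply/measurable_EFinP; exact: measurable_indic.
- by apply/measurable_EFinP; exact: measurable_indic.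
- move=> x x0; rewrite !indicE; congr ((_ : bool)%:R)%:E.
  by apply/idP/idP => /set_mem /= h; apply/mem_set; move: h; rewrite /= ger0_norm.
Qed.

Section reindexed.
Variables (f : R -> R) (rho rho' : nat * nat -> nat * nat).
Hypothesis mf : measurable_fun setT f.
Hypothesis f_exp1 : forall A : set R, measurable A -> exp1 R (f @^-1` A) = exp1 R A.
Hypothesis rhoK : cancel rho rho'.
Hypothesis rho_quadrant : forall z, quadrant (rho z).

Definition reindex (t : T) : env := fun z => f (omega (rho z) t).

Lemma measurable_reindex z : measurable_fun setT (fun t => reindex t z).
Proof. by apply: measurableT_comp. Qed.

Lemma reindex_boxes (J : {fset nat * nat}) (A : nat * nat -> set R) :
  (forall i, measurable (A i)) ->
  P [set t | forall i, i \in J -> A i (reindex t i)] = \prod_(i <- J) exp1 R (A i).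
Proof.
move=> mA; have [indep law] := iid.
have mB i : measurable (f @^-1` A i) by rewrite -[X in measurable X]setTI; exact: mf.
have sub : [set` [fset rho i | i in J]%fset] `<=` quadrant.
  by move=> _ /= /imfsetP[i /= _ ->].
have := indep _ (fun k => f @^-1` A (rho' k)) sub (fun k => mB _).
rewrite big_imfset /=; last by move=> x y _ _; exact: (can_inj rhoK).
rewrite (_ : \bigcap_(i in _) _ =
    [set t | forall i, i \in J -> A i (reindex t i)]); last first.
  apply/seteqP; split=> t /= h.
    by move=> i iJ; have := h (rho i); rewrite /= rhoK; apply; apply/imfsetP; exists i.
  by move=> _ /= /imfsetP[i /= iJ ->]; rewrite rhoK; exact: h.
move=> ->; apply: eq_bigr => i _; rewrite rhoK -f_exp1//.
exact: (law _ (rho_quadrant i)).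
Qed.

Lemma reindex_resample z (F : env -> \bar R) :
  measurable_fun setT F -> (forall v, 0 <= F v) ->
  \int[P]_t F (reindex t) = \int[P]_t \int[exp1 R]_x F (upd (reindex t) z x).
Proof. exact: (exp1_resampling measurable_reindex reindex_boxes). Qed.

Lemma measurable_reindex_env : measurable_fun setT reindex.
Proof. exact: measurable_env measurable_reindex. Qed.

End reindexed.

Lemma probE (b : T -> bool) : measurable_fun setT b ->
  P [set t | b t] = \int[P]_t ((b t)%:R : R)%:E.
Proof.
move=> mb.
have mA : measurable [set t | b t].
  by rewrite -[X in measurable X]setTI; exact: (mb measurableT [set true]).
rewrite measure_indic//; apply: eq_integral => t _.
rewrite indicE; congr ((_ : bool)%:R)%:E.
by apply/idP/idP => [/set_mem //|bt]; apply/mem_set.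
Qed.

Definition shift_index (z : nat * nat) : nat * nat := (z.1.+1, z.2.+1).

Local Notation env_at t := (shift_env (weights_at omega t)).

Lemma measurable_env_at : measurable_fun setT (fun t => env_at t : env).
Proof. by apply: measurable_env => z. Qed.

(** The weight at (i, j + 1) enters one of the two values, additively, and not the other, and
    its law has no atoms. *)
Lemma prob_tie i j :
  P [set t | lpp (env_at t) i j.+1 == lpp (env_at t) i.+1 j] = 0.
Proof.
pose X := reindex id shift_index.
pose F (v : env) : \bar R := ((lpp v i j.+1 == lpp v i.+1 j)%:R)%:E.
have mF : measurable_fun setT F.
  apply: measurable_boolE; apply: measurable_fun_eqr; exact: measurable_lpp.
have F0 v : 0 <= F v by rewrite lee_fin ler0n.
rewrite (@probE (fun t => lpp (env_at t) i j.+1 == lpp (env_at t) i.+1 j)); last first.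
  apply: measurable_fun_eqr; exact: (measurableT_comp (measurable_lpp _ _) measurable_env_at).
transitivity (\int[P]_t F (X t)); first exact: eq_integral.
have sK : cancel shift_index (fun z => (z.1.-1, z.2.-1)) by case.
rewrite (@reindex_resample id shift_index _ (@measurable_id _ _ _) (fun _ _ => erefl) sK _ (i, j.+1)%N F)//.
apply: integral0_eq => t _.
pose c := (lpp (X t) i j.+1 - X t (i, j.+1))%R.
transitivity (\int[exp1 R]_x (\1_[set (lpp (X t) i.+1 j - c)%R] x : R)%:E).
  apply: eq_integral => x _; rewrite /F lpp_upd lpp_upd_out /= ?ltnn ?andbF//.
  rewrite -/c indicE; congr ((_ : bool)%:R)%:E.
  apply/eqP/idP => [xc|/set_mem /= ->]; last by rewrite addrC subrK.
  by apply/mem_set => /=; rewrite -xc addrC addKr.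
by rewrite integral_indic// setIT; exact: exp1_set1.
Qed.

Lemma prob_omega_lt0 z : quadrant z -> P [set t | (omega z t < 0)%R] = 0.
Proof.
move=> qz; have [_ law] := iid.
have mlt : measurable [set x : R | (x < 0)%R].
  have -> : [set x : R | (x < 0)%R] = `]-oo, 0%R[%classic.
    by apply/seteqP; split=> x; rewrite /= in_itv.
  exact: measurable_itv.
have := law z qz _ mlt; rewrite /distribution /pushforward => e.
etransitivity; first exact: e.
exact: (exp1_lt0 R).
Qed.

Lemma almost_surely_good : exists Z : set T, [/\ measurable Z, P Z = 0 &
  forall t, ~ Z t -> no_ties (weights_at omega t) /\
    (forall z, quadrant z -> (0 <= omega z t)%R)].
Proof.
pose tie (z : nat * nat) := [set t | lpp (env_at t) z.1 z.2.+1 == lpp (env_at t) z.1.+1 z.2].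
pose neg (z : nat * nat) := [set t | (omega (shift_index z) t < 0)%R].
have mtie z : measurable (tie z).
  have mb : measurable_fun setT
      (fun t => lpp (env_at t) z.1 z.2.+1 == lpp (env_at t) z.1.+1 z.2).
    apply: measurable_fun_eqr; exact: (measurableT_comp (measurable_lpp _ _) measurable_env_at).
  by rewrite -[X in measurable X]setTI; exact: (mb measurableT [set true]).
have mneg z : measurable (neg z).
  have mb : measurable_fun setT (fun t => (omega (shift_index z) t < 0)%R).
    exact: measurable_fun_ltr.
  by rewrite -[X in measurable X]setTI; exact: (mb measurableT [set true]).
pose bad (k : nat) : set T := if choice.unpickle k is Some z then tie z `|` neg z else set0.
have mbad k : measurable (bad k).
  by rewrite /bad; case: choice.unpickle => // z; exact: measurableU.
have badU : P.-negligible (\bigcup_k bad k).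
  apply: negligible_bigcup => k; rewrite /bad; case: choice.unpickle => [[i j]|]; last first.
    exact: negligible_set0.
  apply: negligibleU; apply/negligibleP => //; first exact: prob_tie.
  exact: prob_omega_lt0.
have mU : measurable (\bigcup_k bad k) by exact: bigcup_measurable.
exists (\bigcup_k bad k); split=> //; first exact/negligibleP.
move=> t nbad; have nb z : ~ (tie z `|` neg z) t.
  by move=> tz; apply: nbad; exists (choice.pickle z) => //; rewrite /bad choice.pickleK.
split=> [i j|[i j] [/= i0 j0]].
  by apply/negP => e; apply: (nb (i, j)); left.
rewrite leNgt; apply/negP => e; apply: (nb (i.-1, j.-1)); right.
by rewrite /neg /shift_index /= !prednK.
Qed.

Lemma prob_from_left (rho rho' : nat * nat -> nat * nat) M N (w w' a : R) :
  cancel rho rho' -> (forall z, quadrant (rho z)) ->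
  (w < 1)%R -> (0 < a < w')%R -> (w' <= w)%R ->
  P [set t | from_left M N (zero_axes (fun z => `|omega (rho z) t|%R))] <=
  (w + exit_bound M.+1 N.+1 w w' a)%:E.
Proof.
move=> rhoK rhoq w1 aw' w'w; pose X := reindex (fun x : R => `|x|%R) rho.
have mn : measurable_fun setT (fun x : R => `|x|%R) by exact: normr_measurable.
have mX : measurable_fun setT X by exact: measurable_reindex_env.
have X0 t z : (0 <= X t z)%R by exact: normr_ge0.
have rs := reindex_resample mn exp1_normr rhoK rhoq.
have := from_left_bulk mX X0 rs M N w1 aw' w'w.
rewrite probE // .
exact: (measurableT_comp (@measurable_from_left R M N)
  (measurableT_comp (@measurable_zero_axes R) mX)).
Qed.

Local Notation h t := (exits_hor (steps_left (env_at t))).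

Lemma measurable_exits_hor_at i j : measurable_fun setT (fun t => h t i j).
Proof. exact: (measurableT_comp (@measurable_exits_hor R i j) measurable_env_at). Qed.

Lemma le_prob_almost (A B : set T) : measurable A -> measurable B ->
  (forall t, no_ties (weights_at omega t) ->
    (forall z, quadrant z -> (0 <= omega z t)%R) -> A t -> B t) -> P A <= P B.
Proof.
move=> mA mB AB; have [Z [mZ Z0 good]] := almost_surely_good.
rewrite -[leRHS]adde0 -Z0; apply: le_trans (measureU2 _ mB mZ).
apply: le_measure; rewrite ?inE//; first exact: measurableU.
move=> t At; have [Zt|nZt] := pselect (Z t); first by right.
by left; have [nt o0] := good t nZt; exact: AB.
Qed.

Lemma measurable_bool_set (b : T -> bool) : measurable_fun setT b -> measurable [set t | b t].
Proof. by move=> mb; rewrite -[X in measurable X]setTI; exact: (mb measurableT [set true]). Qed.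

Lemma prob_exits_hor k l (w w' a : R) :
  (w < 1)%R -> (0 < a < w')%R -> (w' <= w)%R ->
  P [set t | h t k.+1 l.+1] <= (w + exit_bound k.+2 l.+2 w w' a)%:E.
Proof.
move=> w1 aw' w'w.
have := @prob_from_left _ _ k.+1 l.+1 w w' a (@reflect_indexK k.+2 l.+2)
  (@reflect_index_quadrant k.+2 l.+2) w1 aw' w'w.
apply: le_trans; apply: le_prob_almost.
- by apply: measurable_bool_set; exact: measurable_exits_hor_at.
- apply: measurable_bool_set.
  apply: (measurableT_comp (@measurable_from_left R _ _)).
  apply: (measurableT_comp (@measurable_zero_axes R)).
  by apply: measurable_env => z; exact: measurableT_comp.
move=> t nt o0 /= /(T_horP nt _)[]// _.
have [-> ->] := @first_steps_reflected R (weights_at omega t) k l o0.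
by rewrite lte_fin => /ltW.
Qed.

Lemma prob_exits_ver k l (w w' a : R) :
  (w < 1)%R -> (0 < a < w')%R -> (w' <= w)%R ->
  P [set t | ~~ h t k.+1 l.+1] <= (w + exit_bound l.+2 k.+2 w w' a)%:E.
Proof.
move=> w1 aw' w'w.
pose rho z := reflect_index k.+2 l.+2 (swap_index z).
have rhoK : cancel rho (fun z => swap_index (reflect_index_inv k.+2 l.+2 z)).
  by move=> [i j]; rewrite /rho reflect_indexK.
have := @prob_from_left _ _ l.+1 k.+1 w w' a rhoK
  (fun z => @reflect_index_quadrant k.+2 l.+2 _) w1 aw' w'w.
apply: le_trans; apply: le_prob_almost.
- by apply: measurable_bool_set; apply: measurable_neg; exact: measurable_exits_hor_at.
- apply: measurable_bool_set.
  apply: (measurableT_comp (@measurable_from_left R _ _)).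
  apply: (measurableT_comp (@measurable_zero_axes R)).
  by apply: measurable_env => z; exact: measurableT_comp.
move=> t nt o0 /= /(T_verP nt _)[]// _.
have [-> ->] := @first_steps_reflected R (weights_at omega t) k l o0.
rewrite lte_fin /from_left => /ltW.
pose v := zero_axes (fun z => `|weights_at omega t (reflect_index k.+2 l.+2 z)|%R).
rewrite -/v (_ : zero_axes _ = (fun z => v (swap_index z))) ?lpp_swap//.
by apply/funext => z; rewrite /v /zero_axes /= orbC.
Qed.

End weights.

(** * The characteristic parameter *)

Section estimates.
Variable R : realType.

(** The logarithm of the bound is a difference of integrals of M / u + N / (1 - u) over two
    intervals of length e.  This function is minimal near zeta and about quadratic there, so
    replacing [zeta, zeta + e] by the interval centred at zeta gains a multiple of n e ^ 3.
    The slack of 2 in M accommodates rounding. *)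
Lemma exit_bound_le (M N : nat) (n zeta e x S : R) :
  0 < zeta < 1 -> 0 < e -> e <= zeta / 2 -> e <= (1 - zeta) / 2 ->
  1 <= S -> zeta ^+ 2 * S = x -> (1 - zeta) ^+ 2 * S = 1 - x -> 0 <= n ->
  M%:R <= n * x + 2 -> n * (1 - x) <= N%:R ->
  exit_bound M N (zeta + e) (zeta + e / 2) e <= expR (1 - n * e ^+ 3 / 10).
Proof.
move=> /andP[z0 z1] e0 ez ez1 S1 xE x1E n0 Mle Nge.
have z1' : 0 < 1 - zeta by lra.
pose A := (zeta + e / 2) / (zeta + e / 2 - e) * ((zeta + e - e) / (zeta + e)).
pose B := (1 - (zeta + e)) / (1 - (zeta + e) + e) *
  ((1 - (zeta + e / 2) + e) / (1 - (zeta + e / 2))).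
rewrite /exit_bound -/A -/B.
pose h := e / zeta; pose k := e / (1 - zeta).
have h0 : 0 < h by rewrite divr_gt0.
have k0 : 0 < k by rewrite divr_gt0.
have h2 : h <= 1 / 2 by rewrite /h ler_pdivrMr//; lra.
have k2 : k <= 1 / 2 by rewrite /k ler_pdivrMr//; lra.
have eh : e = h * zeta by rewrite /h divfK// gt_eqF.
have ek : e = k * (1 - zeta) by rewrite /k divfK// gt_eqF.
pose y := h ^+ 2 / 2 - h ^+ 3 / 10; pose y2 := k ^+ 2 / 2.
have zn : zeta != 0 by rewrite gt_eqF.
have zn1 : 1 - zeta != 0 by rewrite gt_eqF.
have AE : A = 1 + (h ^+ 2 / 2) / (1 + h / 2 - h ^+ 2 / 2).
  rewrite /A; have -> : zeta + e / 2 - e = zeta * (1 - h / 2) by rewrite eh; field.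
  have -> : zeta + e / 2 = zeta * (1 + h / 2) by rewrite eh; field.
  have -> : zeta + e - e = zeta by ring.
  have -> : zeta + e = zeta * (1 + h) by rewrite eh; field.
  by field; rewrite zn /=; apply/and3P; split; rewrite gt_eqF//; nra.
have Ay : A <= 1 + y.
  rewrite AE lerD2l ler_pdivrMr; last by nra.
  rewrite /y; nra.
have BE : B = 1 - (k ^+ 2 / 2) / (1 - k / 2).
  rewrite /B.
  have -> : 1 - (zeta + e / 2) + e = (1 - zeta) * (1 + k / 2) by rewrite ek; field.
  have -> : 1 - (zeta + e / 2) = (1 - zeta) * (1 - k / 2) by rewrite ek; field.
  have -> : 1 - (zeta + e) + e = 1 - zeta by ring.
  have -> : 1 - (zeta + e) = (1 - zeta) * (1 - k) by rewrite ek; field.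
  by field; rewrite zn1 /= gt_eqF//; lra.
have By : B <= 1 - y2.
  rewrite BE lerD2l lerN2 /y2 ler_pdivlMr; last by lra.
  by rewrite ler_piMr; nra.
have A0 : 0 <= A by rewrite AE addr_ge0// divr_ge0//; nra.
have B0 : 0 <= B.
  rewrite BE subr_ge0 ler_pdivrMr ?mul1r; last by lra.
  nra.
have y0 : 0 <= y by rewrite /y; nra.
(* From here on 1 + u <= expR u; the quadratic parts of the two exponents cancel because
   zeta is the characteristic parameter. *)
have AM : A ^+ M <= expR ((n * x + 2) * y).
  apply: (@le_trans _ _ (expR y ^+ M)).
    by rewrite lerXn2r ?nnegrE ?expR_ge0// (le_trans Ay)// expR_ge1Dx.
  by rewrite -expRM_natl ler_expR mulr_natl -mulr_natl ler_wpM2r.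
have BN : B ^+ N <= expR (- (n * (1 - x) * y2)).
  apply: (@le_trans _ _ (expR (- y2) ^+ N)).
    by rewrite lerXn2r ?nnegrE ?expR_ge0// (le_trans By)// expR_ge1Dx.
  rewrite -expRM_natl ler_expR mulrN lerN2 ler_wpM2r// /y2; nra.
apply: (@le_trans _ _ (expR ((n * x + 2) * y) * expR (- (n * (1 - x) * y2)))).
  by apply: ler_pM => //; exact: exprn_ge0.
rewrite -expRD ler_expR.
have nxy : n * x * y = n * S * (e ^+ 2 / 2) - n * S * (e ^+ 3 / (10 * zeta)).
  by rewrite /y -xE eh; field.
have nxy2 : n * (1 - x) * y2 = n * S * (e ^+ 2 / 2).
  by rewrite /y2 -x1E ek; field.
have y1 : 2 * y <= 1 by rewrite /y; nra.
have main : n * e ^+ 3 / 10 <= n * S * (e ^+ 3 / (10 * zeta)).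
  have -> : n * S * (e ^+ 3 / (10 * zeta)) = n * e ^+ 3 / 10 * (S / zeta) by field.
  apply: ler_peMr; last by rewrite ler_pdivlMr// mul1r; lra.
  by rewrite divr_ge0// mulr_ge0// exprn_ge0// ltW.
rewrite mulrDl nxy nxy2; lra.
Qed.

Definition zeta (x : R) : R := Num.sqrt x / (Num.sqrt x + Num.sqrt (1 - x)).

Lemma zetaC x : 0 < x < 1 -> zeta (1 - x) = 1 - zeta x.
Proof.
move=> /andP[x0 x1]; rewrite /zeta subKr.
have s1 : 0 < Num.sqrt x by rewrite sqrtr_gt0.
have s2 : 0 < Num.sqrt (1 - x) by rewrite sqrtr_gt0; lra.
by field; rewrite gt_eqF//; lra.
Qed.

Lemma zeta_bounds x : 0 < x < 1 -> x / 2 <= zeta x <= 1 - (1 - x) / 2.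
Proof.
move=> x01; have lower y : 0 < y < 1 -> y / 2 <= zeta y.
  move=> /andP[y0 y1]; rewrite /zeta.
  have s1 : 0 < Num.sqrt y by rewrite sqrtr_gt0.
  have s2 : 0 < Num.sqrt (1 - y) by rewrite sqrtr_gt0; lra.
  have e1 : Num.sqrt y ^+ 2 = y by rewrite sqr_sqrtr// ltW.
  have e2 : Num.sqrt (1 - y) ^+ 2 = 1 - y by rewrite sqr_sqrtr//; lra.
  have s1' : Num.sqrt y <= 1 by rewrite -sqrtr1 ler_wsqrtr// ltW.
  have s2' : Num.sqrt (1 - y) <= 1 by rewrite -[leRHS]sqrtr1 ler_wsqrtr//; lra.
  rewrite ler_pdivlMr; last by lra.
  rewrite -{1}e1; move: (Num.sqrt y) (Num.sqrt (1 - y)) s1 s2 s1' s2' => a b *.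
  have : a * (a + b) <= 2 by nra.
  by rewrite expr2 => ?; nra.
rewrite lower//=; have := @lower (1 - x); rewrite zetaC// => h.
by have := h ltac:(move: x01; lra); lra.
Qed.

(** The direction (x, 1 - x) is proportional to (zeta ^ 2, (1 - zeta) ^ 2), which makes zeta
    the minimiser of x / u + (1 - x) / (1 - u). *)
Lemma zeta_char x : 0 < x < 1 -> exists S : R,
  [/\ 1 <= S, zeta x ^+ 2 * S = x & (1 - zeta x) ^+ 2 * S = 1 - x].
Proof.
move=> /andP[x0 x1]; rewrite /zeta.
have s1 : 0 < Num.sqrt x by rewrite sqrtr_gt0.
have s2 : 0 < Num.sqrt (1 - x) by rewrite sqrtr_gt0; lra.
have e1 : Num.sqrt x ^+ 2 = x by rewrite sqr_sqrtr// ltW.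
have e2 : Num.sqrt (1 - x) ^+ 2 = 1 - x by rewrite sqr_sqrtr//; lra.
exists ((Num.sqrt x + Num.sqrt (1 - x)) ^+ 2); split.
- by nra.
- by rewrite -exprMn divfK ?e1// gt_eqF//; lra.
rewrite -exprMn -[RHS]e2; congr (_ ^+ 2).
by field; rewrite gt_eqF//; lra.
Qed.

Definition log_rate (n : nat) : R := (ln n%:R / n%:R) `^ (1 / 3).

Lemma log_rate_gt0 n : (1 < n)%N -> 0 < log_rate n.
Proof.
move=> n1; rewrite /log_rate powR_gt0// divr_gt0//.
  by rewrite ln_gt0// ltr1n.
by rewrite ltr0n; lia.
Qed.

Lemma log_rate3 n : (1 < n)%N -> n%:R * log_rate n ^+ 3 = ln (n%:R : R).
Proof.
move=> n1; have n0 : 0 < n%:R :> R by rewrite ltr0n; lia.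
have q0 : 0 <= ln n%:R / n%:R :> R.
  by rewrite divr_ge0 ?ler0n// ln_ge0// ler1n; lia.
rewrite /log_rate -powR_mulrn ?powR_ge0// -powRrM.
have -> : 1 / 3 * 3%:R = 1 :> R by field.
by rewrite powRr1// mulrC divfK// gt_eqF.
Qed.

Lemma half_le_ln2 : 1 / 2 <= ln (2 : R).
Proof.
have := @le_ln1Dx R (- (1 / 2)) ltac:(lra).
have -> : 1 + - (1 / 2) = 2^-1 :> R by field.
by rewrite lnV ?posrE//; lra.
Qed.

Lemma invn_le_log_rate n : (1 < n)%N -> log_rate n <= 1 -> n%:R^-1 <= 2 * log_rate n.
Proof.
move=> n1 q1; have n0 : 0 < n%:R :> R by rewrite ltr0n; lia.
have q0 := log_rate_gt0 n1; have q3 := log_rate3 n1.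
have l2 : 1 / 2 <= ln (n%:R : R).
  by apply: le_trans half_le_ln2 _; rewrite ler_ln ?posrE// ?ltr0n// ler_nat.
rewrite -[n%:R^-1]mul1r ler_pdivrMr//.
have qq : log_rate n ^+ 3 <= log_rate n.
  by rewrite exprS ler_piMr ?(ltW q0)// exprn_ile1// ltW.
have : n%:R * log_rate n ^+ 3 <= n%:R * log_rate n by rewrite ler_pM2l.
rewrite q3; lra.
Qed.

(** With e = 3 log_rate n one has n e ^ 3 / 10 = 2.7 log n, more than enough for the
    bound 1 / n, which is itself of smaller order than log_rate n. *)
Lemma exp_log_rate_le n : (1 < n)%N -> log_rate n <= 1 ->
  expR (1 - n%:R * (3 * log_rate n) ^+ 3 / 10) <= 2 * expR 1 * log_rate n.
Proof.
move=> n1 q1; have n0 : 0 < n%:R :> R by rewrite ltr0n; lia.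
have l0 : 0 <= ln (n%:R : R) by rewrite ln_ge0// ler1n; lia.
have -> : n%:R * (3 * log_rate n) ^+ 3 / 10 = 27 / 10 * ln (n%:R : R).
  by rewrite -log_rate3//; field.
apply: (@le_trans _ _ (expR 1 * n%:R^-1)).
  rewrite -[in leRHS](@lnK _ n%:R) ?posrE// -expRN -expRD ler_expR; lra.
by rewrite -mulrA mulrCA ler_pM2l ?expR_gt0// invn_le_log_rate.
Qed.

End estimates.

(** * Rate of convergence *)

Section conclusion.
Variable R : realType.
Variables (d : measure_display) (T : measurableType d) (P : probability T R).
Variable omega : nat * nat -> {RV P >-> R}.
Hypothesis iid : iid_exponential_weights omega.

Local Notation h t := (exits_hor (steps_left (shift_env (weights_at omega t)))).

Definition error (n : nat) : R := (3 + 2 * expR 1) * log_rate R n.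

Section fixed_direction.
Variables (n : nat) (x : R).
Hypotheses (n1 : (1 < n)%N) (x01 : 0 < x < 1).
Hypothesis small : 3 * log_rate R n <= Num.min (zeta x) (1 - zeta x) / 2.

Let small1 : 3 * log_rate R n <= zeta x / 2.
Proof. by apply: (le_trans small); rewrite ler_wpM2r ?invr_ge0// ge_min lexx. Qed.

Let small2 : 3 * log_rate R n <= (1 - zeta x) / 2.
Proof. by apply: (le_trans small); rewrite ler_wpM2r ?invr_ge0// ge_min lexx orbT. Qed.

Let zeta01 : 0 < zeta x < 1.
Proof. by have := zeta_bounds x01; move: x01; lra. Qed.

Let exit_bound_error (M N : nat) : M%:R <= n%:R * x + 2 -> n%:R * (1 - x) <= N%:R ->
  zeta x + 3 * log_rate R n +
  exit_bound M N (zeta x + 3 * log_rate R n) (zeta x + 3 * log_rate R n / 2) (3 * log_rate R n)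
  <= zeta x + error n.
Proof.
move=> Mle Nge; have [S [S1 xE x1E]] := zeta_char x01.
have q0 := log_rate_gt0 R n1.
have e0 : 0 < 3 * log_rate R n by lra.
have := exit_bound_le zeta01 e0 small1 small2 S1 xE x1E (ler0n _ n) Mle Nge.
have q1 : log_rate R n <= 1 by move: zeta01 small1; lra.
have := exp_log_rate_le n1 q1; rewrite /error; lra.
Qed.

Lemma prob_exits_hor_le k l : k.+2%:R <= n%:R * x + 2 -> n%:R * (1 - x) <= l.+2%:R ->
  (P [set t | h t k.+1 l.+1] <= (zeta x + error n)%:E)%E.
Proof.
move=> kx lx; have q0 := log_rate_gt0 R n1.
have := @prob_exits_hor _ _ _ _ omega iid k l (zeta x + 3 * log_rate R n)
  (zeta x + 3 * log_rate R n / 2) (3 * log_rate R n).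
move=> H; apply: (le_trans (H _ _ _)); last first.
- by rewrite lee_fin exit_bound_error.
- lra.
- by move: zeta01 small1; lra.
- by move: zeta01 small2; lra.
Qed.

Lemma prob_exits_ver_le k l : l.+2%:R <= n%:R * x + 2 -> n%:R * (1 - x) <= k.+2%:R ->
  (P [set t | ~~ h t k.+1 l.+1] <= (zeta x + error n)%:E)%E.
Proof.
move=> lx kx; have q0 := log_rate_gt0 R n1.
have := @prob_exits_ver _ _ _ _ omega iid k l (zeta x + 3 * log_rate R n)
  (zeta x + 3 * log_rate R n / 2) (3 * log_rate R n).
move=> H; apply: (le_trans (H _ _ _)); last first.
- by rewrite lee_fin exit_bound_error.
- lra.
- by move: zeta01 small1; lra.
- by move: zeta01 small2; lra.
Qed.

End fixed_direction.

Lemma prob_two_sided (A : set T) (p e : R) : measurable A ->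
  (P A <= (p + e)%:E)%E -> (P (~` A) <= (1 - p + e)%:E)%E -> `|fine (P A) - p| <= e.
Proof.
move=> mA; have fA : P A \is a fin_num by exact: fin_num_measure.
rewrite probability_setC// -(fineK fA) -EFinB !lee_fin ler_norml => h1 h2.
by apply/andP; split; lra.
Qed.

Lemma prob_trivial (A : set T) (p e : R) : measurable A -> 0 <= p <= 1 -> 1 <= e ->
  `|fine (P A) - p| <= e.
Proof.
move=> mA p01 e1; apply: prob_two_sided => //.
  apply: (le_trans (probability_le1 P mA)); rewrite lee_fin; lra.
apply: (le_trans (probability_le1 P (measurableC mA))); rewrite lee_fin; lra.
Qed.

Lemma measurable_no_ties : measurable [set t | no_ties (weights_at omega t)].
Proof.
rewrite (_ : [set t | _] = \bigcap_i \bigcap_j [set t |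
    lpp (shift_env (weights_at omega t)) i j.+1 !=
    lpp (shift_env (weights_at omega t)) i.+1 j]).
  apply: bigcapT_measurable => i; apply: bigcapT_measurable => j.
  apply: measurable_bool_set; apply: measurable_neg; apply: measurable_fun_eqr.
    exact: (measurableT_comp (measurable_lpp _ _) (measurable_env_at omega)).
  exact: (measurableT_comp (measurable_lpp _ _) (measurable_env_at omega)).
apply/seteqP; split=> t nt; first by move=> i _ j _; exact: nt.
by move=> i j; exact: (nt i I j I).
Qed.

Lemma prob_uniqueI (A : set T) : measurable A ->
  P ([set t | unique_geodesics (weights_at omega t)] `&` A) = P A.
Proof.
move=> mA.
rewrite (_ : [set t | _] = [set t | no_ties (weights_at omega t)]); last first.
  by apply/seteqP; split=> t /= /unique_geodesicsP.
have mI := measurableI _ _ measurable_no_ties mA.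
apply/eqP; rewrite eq_le; apply/andP; split.
  by apply: le_measure; rewrite ?inE//; exact: subIsetr.
by apply: (le_prob_almost iid) => // t nt _ At.
Qed.

Lemma prob_phi_hor n (x : R) k : (0 < n)%N -> (k <= n)%N ->
  k%:R <= n%:R * x < k.+1%:R ->
  P [set t | unique_geodesics (weights_at omega t) /\
             (phi_hor (weights_at omega t) n)%:R <= n%:R * x] = P [set t | h t k (n - k)%N].
Proof.
move=> n0 kn /andP[k1 k2].
rewrite -[RHS]prob_uniqueI; last exact/measurable_bool_set/measurable_exits_hor_at.
congr (P _); apply/seteqP; split=> t /= [ug].
  move=> le; split=> //; rewrite -phi_hor_le//; last exact/unique_geodesicsP.
  by rewrite -ltnS -(ltr_nat R) (le_lt_trans le).
rewrite -phi_hor_le//; last exact/unique_geodesicsP.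
by move=> le; split=> //; rewrite (le_trans _ k1)// ler_nat.
Qed.

Lemma prob_phi_ver n (x : R) k : (0 < n)%N -> (k <= n)%N ->
  k%:R <= n%:R * x < k.+1%:R ->
  P [set t | unique_geodesics (weights_at omega t) /\
             (phi_ver (weights_at omega t) n)%:R <= n%:R * x] = P [set t | ~~ h t (n - k)%N k].
Proof.
move=> n0 kn /andP[k1 k2].
rewrite -[RHS]prob_uniqueI; last by apply/measurable_bool_set/measurable_neg/measurable_exits_hor_at.
congr (P _); apply/seteqP; split=> t /= [ug].
  move=> le; split=> //; rewrite -phi_ver_le//; last exact/unique_geodesicsP.
  by rewrite -ltnS -(ltr_nat R) (le_lt_trans le).
rewrite -phi_ver_le//; last exact/unique_geodesicsP.
by move=> le; split=> //; rewrite (le_trans _ k1)// ler_nat.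
Qed.

Lemma phi_estimate (delta x : R) n : 0 < delta -> delta <= x <= 1 - delta -> (1 < n)%N ->
  log_rate R n <= delta / 12 ->
  `| fine (P [set t | unique_geodesics (weights_at omega t) /\
                      (phi_hor (weights_at omega t) n)%:R <= n%:R * x]) - zeta x | <= error n
  /\
  `| fine (P [set t | unique_geodesics (weights_at omega t) /\
                      (phi_ver (weights_at omega t) n)%:R <= n%:R * x]) - zeta x | <= error n.
Proof.
move=> d0 /andP[dx x1d] n1 qd.
have x01 : 0 < x < 1 by apply/andP; split; lra.
have y01 : 0 < 1 - x < 1 by apply/andP; split; lra.
have zb := zeta_bounds x01.
have small : 3 * log_rate R n <= Num.min (zeta x) (1 - zeta x) / 2.
  by rewrite ler_pdivlMr// le_min; apply/andP; split; lra.
have small' : 3 * log_rate R n <= Num.min (zeta (1 - x)) (1 - zeta (1 - x)) / 2.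
  by rewrite zetaC// subKr minC.
have n0 : 0 < n%:R :> R by rewrite ltr0n (ltnW n1).
have nd : 6 <= n%:R * delta.
  have := invn_le_log_rate n1 ltac:(lra); rewrite -[n%:R^-1]mul1r ler_pdivrMr// => h1.
  nra.
have nx0 : 0 <= n%:R * x by nra.
pose k := Num.truncn (n%:R * x).
have /andP[k1 k2] : k%:R <= n%:R * x < k.+1%:R by exact: truncn_itv.
have kn : (k < n)%N by rewrite -(ltr_nat R) (le_lt_trans k1)//; nra.
have k0 : (0 < k)%N by rewrite lt0n; apply/eqP => k0; move: k2; rewrite k0; nra.
have nk : n%:R - k%:R = (n - k)%:R :> R by rewrite natrB// ltnW.
have kitv : k%:R <= n%:R * x < k.+1%:R by rewrite k1.
rewrite (prob_phi_hor (ltnW n1) (ltnW kn) kitv) (prob_phi_ver (ltnW n1) (ltnW kn) kitv).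
case: k k0 k1 k2 kn nk {kitv} => // k _ k1 k2 kn nk.
case E : (n - k.+1)%N nk => [|l] nk; first by move: kn; rewrite -subn_gt0 E.
have kS : k.+2%:R = k.+1%:R + 1 :> R by rewrite -natr1.
have lS : l.+2%:R = l.+1%:R + 1 :> R by rewrite -natr1.
split; apply: prob_two_sided.
- exact/measurable_bool_set/measurable_exits_hor_at.
- apply: prob_exits_hor_le => //; lra.
- rewrite -zetaC// (_ : ~` _ = [set t | ~~ h t k.+1 l.+1]); last first.
    by apply/seteqP; split=> t /= /negP.
  apply: prob_exits_ver_le => //; rewrite ?subKr; lra.
- exact/measurable_bool_set/measurable_neg/measurable_exits_hor_at.
- apply: prob_exits_ver_le => //; lra.
- rewrite -zetaC// (_ : ~` _ = [set t | h t l.+1 k.+1]); last first.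
    by apply/seteqP; split=> t /=; [move/negP; rewrite negbK|move=> ->].
  apply: prob_exits_hor_le => //; rewrite ?subKr; lra.
Qed.

End conclusion.

Theorem theorem2p9 (R : realType) (delta : R) (delta_gt0 : 0 < delta) :
  exists2 C0 : R, 0 < C0 &
  forall (d : measure_display) (T : measurableType d) (P : probability T R)
    (omega : nat * nat -> {RV P >-> R}),
  iid_exponential_weights omega ->
  forall (x : R) (n : nat), delta <= x <= 1 - delta -> (1 < n)%N ->
    `| fine (P [set t | unique_geodesics (weights_at omega t) /\
                        (phi_hor (weights_at omega t) n)%:R <= n%:R * x])
       - Num.sqrt x / (Num.sqrt x + Num.sqrt (1 - x)) |
      <= C0 * (ln n%:R / n%:R) `^ (1 / 3)
    /\
    `| fine (P [set t | unique_geodesics (weights_at omega t) /\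
                        (phi_ver (weights_at omega t) n)%:R <= n%:R * x])
       - Num.sqrt x / (Num.sqrt x + Num.sqrt (1 - x)) |
      <= C0 * (ln n%:R / n%:R) `^ (1 / 3).
Proof.
have e0 : 0 < expR 1 :> R by exact: expR_gt0.
have d12 : 0 < 12 / delta by rewrite divr_gt0.
exists (12 / delta + (3 + 2 * expR 1)); first by lra.
move=> d T P omega iid x n /andP[dx x1d] n1.
have q0 := log_rate_gt0 R n1.
rewrite -/(zeta x) -/(log_rate R n).
(* If log_rate n is not small compared with delta, the bound exceeds 1. *)
have [qd|qd] := leP (log_rate R n) (delta / 12).
  have [h1 h2] := phi_estimate iid delta_gt0 (introT andP (conj dx x1d)) n1 qd.
  have eC : error R n <= (12 / delta + (3 + 2 * expR 1)) * log_rate R n.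
    by rewrite /error ler_pM2r//; lra.
  by split; [exact: le_trans h1 eC|exact: le_trans h2 eC].
have x01 : 0 < x < 1 by apply/andP; split; lra.
have zb := zeta_bounds x01.
have z01 : 0 <= zeta x <= 1 by apply/andP; split; lra.
have C1 : 1 <= (12 / delta + (3 + 2 * expR 1)) * log_rate R n.
  have : 1 <= 12 / delta * log_rate R n.
    by rewrite mulrAC ler_pdivlMr//; lra.
  nra.
have nx0 : 0 <= n%:R * x by rewrite mulr_ge0 ?ler0n//; lra.
have kitv : (Num.truncn (n%:R * x))%:R <= n%:R * x < (Num.truncn (n%:R * x)).+1%:R.
  exact: truncn_itv.
have kn : (Num.truncn (n%:R * x) <= n)%N.
  rewrite -(ler_nat R); have /andP[k1 _] := kitv; apply: (le_trans k1).
  by rewrite ler_piMr ?ler0n//; lra.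
rewrite (prob_phi_hor iid (ltnW n1) kn kitv) (prob_phi_ver iid (ltnW n1) kn kitv).
split; apply: prob_trivial => //; apply: measurable_bool_set.
  exact: measurable_exits_hor_at.
by apply: measurable_neg; exact: measurable_exits_hor_at.
Qed.
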